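(* Let $0 \le a < b$ be reals. The problem $\mathsf{StackMST}(0,0)$ restricted to instances in which the red tree is a path $P$ and every red edge cost lies in $\{a,b\}$ can be solved optimally in polynomial time.
   Context: Budgeted Stackelberg MST game $\mathsf{StackMST}(\gamma,\Delta)$: we are given a tree $T=(V,E(T))$ on $n$ vertices whose (red) edges have fixed costs $c(e)\ge 0$, a non-negative activation cost $\gamma(e)$ for every pair $e=\{u,v\}\notin E(T)$ of vertices (potential blue edges), and a budget $\Delta$. The leader selects a set $F$ of pairs not in $E(T)$ with $\sum_{e\in F}\gamma(e)\le\Delta$ and a price function $p:F\to\mathbb{R}^+$. The follower then computes a minimum spanning tree $M(F,p)$ of the graph $(V,E(T)\cup F)$, where red edges are weighted by $c$ and edges of $F$ by $p$; among several minimum spanning trees the follower picks one maximizing the leader's revenue. The leader's revenue is $\sum_{e\in F\cap M(F,p)}p(e)$, and the goal is to maximize it. $\mathsf{StackMST}(0,0)$ denotes the special case $\gamma\equiv 0$, $\Delta=0$, i.e. the leader may add any set of new edges between vertices of $V$ at no cost. *)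

(* Defs.v *)
From HB Require Import structures.
From mathcomp Require Import all_boot all_order all_algebra.
From mathcomp Require Import reals.
Set Implicit Arguments. Unset Strict Implicit. Unset Printing Implicit Defensive.
Import Order.TTheory GRing.Theory Num.Theory.
Local Open Scope ring_scope.

(* An instance is given by a label sequence lab : seq bool of length n-1;  *)
(* the red tree is the path 0 - 1 - ... - (n-1) on vertex set 'I_n with    *)
(* n = (size lab).+1; the red edge {i,i+1} has cost b if nth false lab i,  *)
(* and cost a otherwise.  An (unordered) pair {u,v} is represented by the  *)
(* ordered pair (u,v) with u < v.                                          *)

Section Game.
Variable R : realType.
Variables (a b : R) (lab : seq bool).

Definition nV := (size lab).+1.
Definition edge := ('I_nV * 'I_nV)%type.

Definition pathE : {set edge} :=
  [set e : edge | (val e.2 == (val e.1).+1)%N].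

Definition red_cost (e : edge) : R := if nth false lab (val e.1) then b else a.

Definition valid_blue (F : {set edge}) : Prop :=
  forall e, e \in F -> (val e.1 < val e.2)%N /\ e \notin pathE.

(* price functions p : F -> R^+ (only the values on F matter) *)
Definition valid_price (F : {set edge}) (p : edge -> R) : Prop :=
  forall e, e \in F -> 0 <= p e.

Section Follower.
Variables (F : {set edge}) (p : edge -> R).

Definition weight_of (e : edge) : R := if e \in pathE then red_cost e else p e.

Definition spanning_tree (S : {set edge}) : Prop :=
  [/\ S \subset pathE :|: F,
      #|S| = (nV.-1)%N &
      forall x y : 'I_nV,
        connect [rel u v : 'I_nV | ((u, v) \in S) || ((v, u) \in S)] x y].

Definition tree_weight (S : {set edge}) : R := \sum_(e in S) weight_of e.

Definition revenue (S : {set edge}) : R := \sum_(e in S :&: F) p e.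

Definition follower_choice (S : {set edge}) : Prop :=
  [/\ spanning_tree S,
      forall S', spanning_tree S' -> tree_weight S <= tree_weight S' &
      forall S', spanning_tree S' -> tree_weight S' = tree_weight S ->
                 revenue S' <= revenue S].

Definition leader_revenue (v : R) : Prop :=
  exists S, follower_choice S /\ v = revenue S.
End Follower.

Definition optimal_strategy (F : {set edge}) (p : edge -> R) : Prop :=
  [/\ valid_blue F, valid_price F p &
      exists v, leader_revenue F p v /\
        forall F' p' v', valid_blue F' -> valid_price F' p' ->
          leader_revenue F' p' v' -> v' <= v].

(* A solution written as a list of triples (u, v, price), price = a if the
   flag is false and b if it is true. *)
Definition sol_set (L : seq (nat * nat * bool)) : {set edge} :=
  [set e : edge | (val e.1, val e.2) \in [seq t.1 | t <- L]].

Definition sol_price (L : seq (nat * nat * bool)) (e : edge) : R :=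
  if (val e.1, val e.2, true) \in L then b else a.

Definition sol_wf (L : seq (nat * nat * bool)) : Prop :=
  uniq [seq t.1 | t <- L] /\
  all (fun t => (t.1.1 < t.1.2 < nV)%N) L.
End Game.

(* sep = None ("#").  A tape cell is an option sym, None being blank.      *)

Definition sym := option bool.
Notation s0 := (Some false : sym).
Notation s1 := (Some true : sym).
Notation sep := (None : sym).
Definition cell := option sym.

Inductive move := MoveL | MoveR | Stay.

(* tape = (cells left of the head, nearest first; head cell; cells right) *)
Definition tape := (seq cell * cell * seq cell)%type.

Definition tape_head (t : tape) : cell := t.1.2.
Definition tape_write (c : cell) (t : tape) : tape := (t.1.1, c, t.2).
Definition tape_move (m : move) (t : tape) : tape :=
  let: (l, c, r) := t in
  match m with
  | Stay => t
  | MoveL => match l with [::] => ([::], None, c :: r)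
                        | x :: l' => (l', x, c :: r) end
  | MoveR => match r with [::] => (c :: l, None, [::])
                        | x :: r' => (c :: l, x, r') end
  end.
Definition tape_word (t : tape) : seq sym :=
  let: (l, c, r) := t in pmap id (rev l ++ c :: r).
Definition tape_of (w : seq sym) : tape :=
  match w with [::] => ([::], None, [::]) | x :: w' => ([::], Some x, map Some w') end.
Definition blank_tape : tape := ([::], None, [::]).

Record OTM := {
  tm_state : finType;
  tm_start : tm_state;
  tm_halt : tm_state;
  tm_query : tm_state;
  tm_yes : tm_state;
  tm_no : tm_state;
  tm_delta : tm_state -> cell -> cell -> (tm_state * cell * cell * move * move)
}.

Definition config (M : OTM) := (tm_state M * tape * tape)%type.

Definition tm_step (M : OTM) (orc : seq sym -> bool) (c : config M) : config M :=
  let: (q, t1, t2) := c in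
  if q == tm_halt M then c
  else if q == tm_query M then
    ((if orc (tape_word t2) then tm_yes M else tm_no M), t1, t2)
  else
    let: (q', w1, w2, m1, m2) := tm_delta q (tape_head t1) (tape_head t2) in
    (q', tape_move m1 (tape_write w1 t1), tape_move m2 (tape_write w2 t2)).

Definition tm_init (M : OTM) (w : seq sym) : config M :=
  (tm_start M, tape_of w, blank_tape).

Definition tm_computes (M : OTM) (orc : seq sym -> bool) (w : seq sym)
    (T : nat) (out : seq sym) : Prop :=
  let c := iter T (tm_step orc) (tm_init M w) in
  c.1.1 = tm_halt M /\ tape_word c.1.2 = out.

Definition enc_nat (k : nat) : seq sym := nseq k s1.

Definition enc_input (lab : seq bool) : seq sym := [seq Some x | x <- lab].

Definition enc_triple (t : nat * nat * bool) : seq sym :=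
  enc_nat t.1.1 ++ sep :: enc_nat t.1.2 ++ sep :: [:: Some t.2; sep].

Definition enc_output (L : seq (nat * nat * bool)) : seq sym :=
  flatten [seq enc_triple t | t <- L].

(* oracle query "p1*a + p2*b <= q1*a + q2*b ?" *)
Definition enc_query (p1 p2 q1 q2 : nat) : seq sym :=
  enc_nat p1 ++ sep :: enc_nat p2 ++ sep :: enc_nat q1 ++ sep :: enc_nat q2.

Definition comparison_oracle (R : realType) (a b : R) (orc : seq sym -> bool) : Prop :=
  forall p1 p2 q1 q2 : nat,
    orc (enc_query p1 p2 q1 q2) = (p1%:R * a + p2%:R * b <= q1%:R * a + q2%:R * b).

Arguments optimal_strategy {R} a b lab F p.
Arguments sol_price {R} a b lab L e.
Arguments sol_set lab L.
Arguments sol_wf lab L.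
Arguments leader_revenue {R} a b lab F p v.
Arguments comparison_oracle {R} a b orc.

(* Main.v *)
(* Let F consist of all pairs of non-adjacent vertices, each priced a or b.  The
   edges of weight <= a of a minimum spanning tree split the vertices into
   clusters, each a union of a-components (components of the red a-edges).
   Compared with collecting the full weight of the red tree, every merge of two
   clusters costs b - a and every red a-edge in the tree costs a.  The non-adjacent
   pairs inside a set of vertices connect it unless it consists of 2 or 3
   consecutive vertices, so exactly the "bad" a-components, those of size 2 or 3,
   cost anything when left alone.  With m bad components, m <= r + 2 j for r kept
   red edges and j merges, and the optimum pairs up the bad components or leaves
   them alone according to how b compares with 3a and 2a; for b < 2a and m odd the
   last bad component joins one more component, the first or the last.  The only
   path on more than 3 vertices where this fails is b, a, b: there the optimum is
   max(3a, 2b).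

   So the price of (u, v) depends on three constant oracle queries and on the run
   of a finite automaton over the path with u and v marked; a two-tape machine
   runs it for every pair in polynomial time. *)
Require Import Defs.
From HB Require Import structures.
From mathcomp Require Import all_boot all_order all_algebra.
From mathcomp Require Import reals boolp.
From mathcomp Require Import zify ring lra.
Set Implicit Arguments. Unset Strict Implicit. Unset Printing Implicit Defensive.
Import Order.TTheory GRing.Theory Num.Theory.

(** * Graphs: components, forests, exchange *)

(** The thresholds come from comparing losses. Two bad components left alone keep two red edges and
    lose 2a, while merging them loses b - a: merging pays if b <= 3a. A single bad component left
    alone loses a, so a merge spent on it alone pays if b <= 2a. Components need not be neighbours
    to be merged; only the span of their union matters. This is why the unpaired bad component is
    joined to an end of the path, where the span on that side is widest. A rival may use arbitrary
    prices, but two facts about its tree suffice: the edges of weight at most a connect every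
    a-component, and no edge weighs more than b. The rest is counting. For the value attained, trees
    are handled through ranks of nested edge sets: a Kruskal tree that breaks ties for the leader
    has its weight and revenue determined by these ranks, so only numbers of components have to be
    estimated. *)

Section Adjacency.
Variable V : finType.
Implicit Types (E S A : {set V * V}) (e : V * V) (x y z : V).

Definition adj E : rel V := [rel u v : V | ((u, v) \in E) || ((v, u) \in E)].

Definition conn E : rel V := connect (adj E).

Lemma adjE E x y : adj E x y = ((x, y) \in E) || ((y, x) \in E).
Proof. by []. Qed.

Lemma adj_sym E : symmetric (adj E).
Proof. by move=> x y; exact: orbC. Qed.

Lemma conn_sym E : connect_sym (adj E).
Proof. exact/sym_connect_sym/adj_sym. Qed.

Lemma connC E x y : conn E x y = conn E y x.
Proof. exact: conn_sym. Qed.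

Lemma conn0 E x : conn E x x.
Proof. exact: connect0. Qed.

Lemma conn_trans E : transitive (conn E).
Proof. exact: connect_trans. Qed.

Lemma conn_edge E e : e \in E -> conn E e.1 e.2.
Proof. by case: e => x y eE; apply: connect1; rewrite adjE eE. Qed.

Lemma conn_sub_edges E E' :
  (forall e, e \in E -> conn E' e.1 e.2) -> subrel (conn E) (conn E').
Proof.
move=> H; apply: connect_sub => x y /orP[/H//|/H /=].
by rewrite connC.
Qed.

Lemma conn_subset E E' : E \subset E' -> subrel (conn E) (conn E').
Proof. by move=> /subsetP sE; apply: conn_sub_edges => e /sE; apply: conn_edge. Qed.

Lemma conn_bridge E e x y : conn (e |: E) x y ->
  [|| conn E x y, conn E x e.1 && conn E e.2 y | conn E x e.2 && conn E e.1 y].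
Proof.
pose P x y := [|| conn E x y, conn E x e.1 && conn E e.2 y
                | conn E x e.2 && conn E e.1 y].
have tr := @conn_trans E.
case/connectP=> p; elim: p x => [|z p IHp] x /=; first by move=> _ ->; rewrite conn0.
case/andP=> xz /IHp/[apply]; rewrite -/(P z y) -/(P x y) => Pzy.
have [[-> zE]|[[-> zE]|xz']] : (x = e.1 /\ z = e.2) \/ (x = e.2 /\ z = e.1) \/ adj E x z.
  move: xz; rewrite !adjE !inE => /orP[] /orP[/eqP<-|H]; rewrite /= ?H ?orbT; auto.
- rewrite zE in Pzy; rewrite /P conn0 /=.
  by case/or3P: Pzy => [->|/andP[_ ->]|/andP[_ ->]]; rewrite ?orbT.
- rewrite zE in Pzy; rewrite /P conn0 /=.
  by case/or3P: Pzy => [->|/andP[_ ->]|/andP[_ ->]]; rewrite ?orbT.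
have cxz : conn E x z by exact: connect1.
by case/or3P: Pzy => [/(tr _ _ _ cxz) H|/andP[/(tr _ _ _ cxz) H H']|/andP[/(tr _ _ _ cxz) H H']];
  rewrite /P H ?H' ?orbT.
Qed.

End Adjacency.

(* Locked: conversion would otherwise try to compute components. *)
HB.lock Definition ncomp (V : finType) (E : {set V * V}) : nat := n_comp (adj E) predT.
HB.lock Definition rk (V : finType) (E : {set V * V}) : nat := #|V| - ncomp E.

Section Components.
Variable V : finType.
Implicit Types (E S A : {set V * V}) (e : V * V) (x y z : V).

Lemma ncompE E : ncomp E = #|roots (adj E)|.
Proof. by rewrite ncomp.unlock; apply: eq_card => x; rewrite !inE andbT. Qed.

Lemma connRoot E x y : (fingraph.root (adj E) x == fingraph.root (adj E) y) = conn E x y.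
Proof. by rewrite root_connect //; exact: conn_sym. Qed.

Lemma root_roots E x : fingraph.root (adj E) x \in roots (adj E).
Proof. by apply: roots_root; exact: conn_sym. Qed.

(** Distinct roots get distinct representatives, since a common one would join them. With
    [ncomp_ge_inj] this bounds [ncomp] from both sides by explicit lists. *)
Lemma ncomp_le_reps E (s : seq V) :
  (forall x, exists2 y, y \in s & conn E x y) -> ncomp E <= size s.
Proof.
move=> H; rewrite ncompE; apply: leq_trans (card_size s).
pose f x := odflt x [pick y in s | conn E x y].
have fP x : f x \in s /\ conn E x (f x).
  rewrite /f; case: pickP => [y /andP[]//|F].
  by have [y ys xy] := H x; have := F y; rewrite /= ys xy.
rewrite -(card_in_image (f := f)).
  by apply/subset_leq_card/subsetP => _ /imageP[x _ ->]; case: (fP x).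
move=> x y; rewrite !inE => /eqP rx /eqP ry fxy.
rewrite -rx -ry; apply/eqP; rewrite connRoot.
apply: (conn_trans (fP x).2); rewrite fxy connC.
by case: (fP y).
Qed.

Lemma conn_const (T : eqType) E (f : V -> T) :
  (forall e, e \in E -> f e.1 = f e.2) -> forall x y, conn E x y -> f x = f y.
Proof.
move=> H x y /connectP[p]; elim: p x => [|z p IHp] x /=; first by move=> _ ->.
case/andP=> xz /IHp/[apply] <-.
by case/orP: xz => /H.
Qed.

(** Dual certificate: [f] is constant on components, so vertices with distinct values lie in
    distinct components. *)
Lemma ncomp_ge_inj (T : eqType) E (f : V -> T) (s : seq V) :
  (forall e, e \in E -> f e.1 = f e.2) -> uniq [seq f x | x <- s] ->
  size s <= ncomp E.
Proof.
move=> H us; rewrite ncompE.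
rewrite -(size_map (fingraph.root (adj E))).
have U : uniq [seq fingraph.root (adj E) x | x <- s].
  rewrite map_inj_in_uniq ?(map_uniq us) // => x y xs ys /eqP.
  rewrite connRoot => /(conn_const H); elim: s us x y xs ys => //= a s IH /andP[fas us] x y.
  rewrite !inE => /predU1P[->|xs] /predU1P[->|ys] //; last exact: IH.
    by move=> fxy; rewrite fxy map_f in fas.
  by move=> fxy; rewrite -fxy map_f in fas.
rewrite -(card_uniqP U).
apply/subset_leq_card/subsetP => _ /mapP[x _ ->].
exact: root_roots.
Qed.

Lemma ncomp_antimono E E' : subrel (conn E) (conn E') -> ncomp E' <= ncomp E.
Proof.
move=> sE; rewrite (ncompE E) cardE; apply: ncomp_le_reps => x.
exists (fingraph.root (adj E) x); last exact/sE/connect_root.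
by rewrite mem_enum root_roots.
Qed.

Lemma ncomp_subset E E' : E \subset E' -> ncomp E' <= ncomp E.
Proof. by move/conn_subset/ncomp_antimono. Qed.

Lemma ncomp0 : ncomp (set0 : {set V * V}) = #|V|.
Proof.
apply/eqP; rewrite eqn_leq; apply/andP; split; first by rewrite ncompE max_card.
rewrite cardE; apply: (ncomp_ge_inj (f := id)); last by rewrite map_id enum_uniq.
by move=> e; rewrite inE.
Qed.

Lemma ncomp_add E e : ncomp E <= (ncomp (e |: E)).+1.
Proof.
pose r := fingraph.root (adj (e |: E)).
have csym := conn_sym (e |: E).
pose K := r e.1.
have Kr : K \in roots (adj (e |: E)) by exact: root_roots.
have -> : (ncomp (e |: E)).+1 = size (e.1 :: e.2 :: enum [pred x in roots (adj (e |: E)) | x != K]).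
  rewrite /= -cardE ncompE (cardD1 K) Kr add1n; congr (_.+2).
  by apply: eq_card => x; rewrite !inE andbC.
apply: ncomp_le_reps => x.
have [rxK|rxK] := eqVneq (r x) K.
  have : conn (e |: E) x e.1 by rewrite -connRoot; apply/eqP.
  case/conn_bridge/or3P => [?|/andP[?]|/andP[? _]].
  - by exists e.1; rewrite ?inE ?eqxx.
  - by exists e.1; rewrite ?inE ?eqxx.
  - by exists e.2; rewrite ?inE ?eqxx ?orbT.
exists (r x).
  rewrite !in_cons mem_enum; apply/or3P/Or33.
  by apply/andP; split; first exact: root_roots.
have nxe : ~~ conn (e |: E) x e.1 by rewrite -connRoot.
have sE : subrel (conn E) (conn (e |: E)) by apply/conn_subset/subsetUr.
have e12 : conn (e |: E) e.1 e.2 by apply: conn_edge; rewrite setU11.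
have : conn (e |: E) x (r x) by exact: connect_root.
case/conn_bridge/or3P => [//|/andP[/sE H]|/andP[/sE H _]]; first by rewrite H in nxe.
by case/negP: nxe; apply: conn_trans H _; rewrite connC.
Qed.

Lemma ncomp_add_disc E e : ~~ conn E e.1 e.2 -> ncomp E = (ncomp (e |: E)).+1.
Proof.
move=> nce; apply/eqP; rewrite eqn_leq ncomp_add /=.
pose r := fingraph.root (adj (e |: E)).
have csym := conn_sym (e |: E).
have sE : subrel (conn E) (conn (e |: E)) by apply/conn_subset/subsetUr.
have e12 : conn (e |: E) e.1 e.2 by apply: conn_edge; rewrite setU11.
have rK x : conn (e |: E) x (r x) by exact: connect_root.
(* one root more: the endpoint of [e] not joined to the root of its class *)
pose z := if conn E e.1 (r e.1) then e.2 else e.1.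
have znr : ~~ conn E z (r z).
  rewrite /z; case: ifPn => // c1.
  have -> : r e.2 = r e.1 by apply/eqP; rewrite connRoot connC.
  by apply: contra nce => c2; apply: conn_trans c1 _; rewrite connC.
rewrite ncompE cardE.
have -> : (size (enum (roots (adj (e |: E))))).+1 = size (z :: enum (roots (adj (e |: E)))) by [].
apply: (ncomp_ge_inj (f := fingraph.root (adj E))) => [f fE|].
  by apply/eqP; rewrite connRoot conn_edge.
rewrite map_inj_in_uniq /= ?enum_uniq ?andbT.
  rewrite mem_enum unfold_in; apply: contra znr => /eqP zr.
  by rewrite [r z]zr; exact: connect0.
move=> x y; rewrite !inE !mem_enum ![_ \in roots _]unfold_in => xs ys /eqP; rewrite connRoot => cxy.
have rr a b : r a == a -> r b == b -> conn E a b -> a = b.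
  by move=> /eqP ra /eqP rb /sE cab; rewrite -ra -rb; apply/eqP; rewrite connRoot.
have rz a : r a == a -> conn E z a -> False.
  move=> /eqP ra cza; case/negP: znr.
  suff -> : r z = a by [].
  by rewrite -ra; apply/eqP; rewrite connRoot; apply: sE.
case/predU1P: xs cxy => [->|xs]; case/predU1P: ys => [->|ys] //; last exact: rr.
  by move=> /(rz _ ys).
by rewrite connC => /(rz _ xs).
Qed.

Lemma card_ncomp E : #|V| <= ncomp E + #|E|.
Proof.
elim: {E}#|E| {-2}E (erefl #|E|) => [|k IHk] E cE.
  by rewrite (cards0_eq cE) ncomp0 cards0 addn0.
have [e eE] : exists e, e \in E by apply/set0Pn; rewrite -card_gt0 cE.
have cE' : #|E :\ e| = k by move: cE; rewrite (cardsD1 e) eE => -[].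
apply: leq_trans (IHk _ cE') _; rewrite cE' cE addnS -addSn leq_add2r.
by rewrite -{2}(setD1K eE) ncomp_add.
Qed.

(** Acyclicity as equality in [card_ncomp], which avoids reasoning about cycles. *)
Definition forest S := ncomp S + #|S| == #|V|.

(** A new edge lowers [ncomp] by at most one, so the sum of [ncomp] and cardinality grows with the
    set; it is at least [#|V|] everywhere and equals it at [S]. *)
Lemma forest_sub S A : forest S -> A \subset S -> forest A.
Proof.
move=> fS sAS; rewrite /forest eqn_leq card_ncomp andbT.
elim: {A}#|S :\: A| {-2}A (erefl #|S :\: A|) sAS => [|k IHk] A cA sAS.
  move/eqP: cA; rewrite cards_eq0 setD_eq0 => sSA.
  by have -> : A = S; [apply/eqP; rewrite eqEsubset sAS | rewrite (eqP fS)].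
have [e] : exists e, e \in S :\: A by apply/set0Pn; rewrite -card_gt0 cA.
rewrite inE => /andP[eA eS].
have sAeS : e |: A \subset S by rewrite subUset sub1set eS.
have cAe : #|S :\: (e |: A)| = k.
  move: cA; rewrite (cardsD1 e) inE eA eS => -[] <-.
  by apply: eq_card => x; rewrite !inE negb_or; case: eqVneq.
apply: leq_trans (IHk _ cAe sAeS); rewrite cardsU1 eA add1n addnS -addSn leq_add2r.
exact: ncomp_add.
Qed.

Lemma forest_extend S E : forest S -> S \subset E ->
  exists S', [/\ S \subset S', S' \subset E, forest S' & ncomp S' = ncomp E].
Proof.
elim: {S}#|E :\: S| {-2}S (erefl #|E :\: S|) => [|k IHk] S cS fS sSE.
  exists S; split=> //; move/eqP: cS; rewrite cards_eq0 setD_eq0 => sES.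
  by congr ncomp; apply/eqP; rewrite eqEsubset sSE.
have [/forall_inP H|] := boolP [forall e in E, conn S e.1 e.2].
  exists S; split=> //; apply/eqP; rewrite eqn_leq [ncomp E <= _]ncomp_subset // andbT.
  exact/ncomp_antimono/conn_sub_edges.
rewrite negb_forall_in => /exists_inP[e eE nce].
have eS : e \notin S by apply: contra nce; apply: conn_edge.
have [|||S' [sS' sS'E fS' nS']] := IHk (e |: S).
- move: cS; rewrite (cardsD1 e) inE eE eS => -[] <-.
  by apply: eq_card => x; rewrite !inE negb_or; case: eqVneq.
- by rewrite /forest cardsU1 eS addnCA add1n -addSn -ncomp_add_disc.
- by rewrite subUset sub1set eE.
by exists S'; split=> //; apply: subset_trans sS'; apply: subsetUr.
Qed.

Lemma rkE E : rk E = #|V| - ncomp E.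
Proof. by rewrite rk.unlock. Qed.

(** Kruskal with priorities: a maximal forest of each level is extended to the next. It already has
    full rank in its level, so no later edge falls into that level. The levels will be the cheap
    blue edges, the red [a]-edges, the other blue edges and the red [b]-edges, so that ties go to
    the leader. *)
Lemma kruskal3 (E1 E2 E3 E4 : {set V * V}) :
  E1 \subset E2 -> E2 \subset E3 -> E3 \subset E4 ->
  exists S, [/\ S \subset E4, forest S, ncomp S = ncomp E4 &
    [/\ #|S :&: E1| = rk E1, #|S :&: E2| = rk E2 & #|S :&: E3| = rk E3]].
Proof.
move=> s12 s23 s34.
have f0 : forest set0 by rewrite /forest ncomp0 cards0 addn0.
have [S1 [_ S1E f1 n1]] := forest_extend f0 (sub0set E1).
have [S2 [S12 S2E f2 n2]] := forest_extend f1 (subset_trans S1E s12).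
have [S3 [S23 S3E f3 n3]] := forest_extend f2 (subset_trans S2E s23).
have [S [S34 SE f4 n4]] := forest_extend f3 (subset_trans S3E s34).
have cap (T E : {set V * V}) : T \subset S -> T \subset E -> forest T -> ncomp T = ncomp E ->
    #|S :&: E| = rk E.
  move=> TS TE fT nT; rewrite rkE.
  have /eqP f : forest (S :&: E) by apply: forest_sub f4 _; apply: subsetIl.
  have le1 := ncomp_subset (subsetIr S E).
  have le2 : #|T| <= #|S :&: E| by apply: subset_leq_card; rewrite subsetI TS.
  move/eqP: fT f nT le1 le2; clear.
  move: (ncomp T) (ncomp (S :&: E)) (ncomp E) #|S :&: E| #|T| #|V| => *; lia.
exists S; split=> //; split.
- by apply: (cap S1) => //; apply: subset_trans S34; apply: subset_trans S23.
- by apply: (cap S2) => //; apply: subset_trans S34.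
- exact: (cap S3).
Qed.

Lemma ncomp_gt0 E (x : V) : 0 < ncomp E.
Proof.
apply: (@ncomp_ge_inj _ E (fingraph.root (adj E)) [:: x]) => // e eE.
by apply/eqP; rewrite connRoot conn_edge.
Qed.

Lemma ncomp_connected E : (forall x y, conn E x y) -> ncomp E <= 1.
Proof.
move=> H; have [x _|V0] := pickP (@predT V).
  by apply: (@ncomp_le_reps E [:: x]) => y; exists x; rewrite ?inE.
by apply: leq_trans (@ncomp_le_reps E [::] _) _ => // y; have := V0 y.
Qed.

Lemma connected_ncomp E x y : ncomp E <= 1 -> conn E x y.
Proof.
rewrite ncompE => /card_le1_eqP H; rewrite -connRoot; apply/eqP/H;
  exact: root_roots.
Qed.

(* Basis exchange: a minimal superset of [A] in [S] joining the ends of [r] contains the edge to drop. *)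
Lemma exchange S A r : A \subset S -> conn S r.1 r.2 -> ~~ conn A r.1 r.2 ->
  exists2 e, e \in S :\: A & subrel (conn S) (conn (r |: S :\ e)).
Proof.
move=> sAS cS ncA.
pose P (B : {set V * V}) := (A \subset B) && conn B r.1 r.2.
have [B /minsetP[/andP[sAB cB] minB] sBS] := minset_exists (introT andP (conj sAS cS) : P S).
have [e eBA] : exists e, e \in B :\: A.
  apply/set0Pn; rewrite setD_eq0; apply: contra ncA => sBA.
  exact: conn_subset sBA _ _ cB.
move: (eBA); rewrite inE => /andP[eA eB].
exists e; first by rewrite inE eA (subsetP sBS).
have ncB : ~~ conn (B :\ e) r.1 r.2.
  apply/negP => c.
  have sAe : A \subset B :\ e.
    by apply/subsetP => x xA; rewrite !inE (subsetP sAB) // andbT; apply: contraNneq eA => <-.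
  have := minB (B :\ e) (introT andP (conj sAe c)) (subsetDl _ _).
  by move/setP/(_ e); rewrite !inE eqxx eB.
have sB' : subrel (conn (B :\ e)) (conn (r |: S :\ e)).
  by apply: conn_subset; apply: subset_trans (subsetUr _ _); apply: setSD.
have rr : conn (r |: S :\ e) r.1 r.2 by apply: conn_edge; rewrite setU11.
have tr := @conn_trans V (r |: S :\ e).
apply: conn_sub_edges => f fS; have [->|fe] := eqVneq f e; last first.
  by apply: conn_edge; rewrite !inE fe fS orbT.
move: cB; rewrite -{1}(setD1K eB) => /conn_bridge/or3P[c|/andP[c1 c2]|/andP[c1 c2]].
- by rewrite c in ncB.
- move/sB': c1; move/sB': c2; rewrite (connC _ e.2) (connC _ r.1) => c2 c1.
  exact: tr (tr _ _ _ c1 rr) c2.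
- move/sB': c1; move/sB': c2; rewrite connC in rr; move=> c2 c1.
  exact: tr (tr _ _ _ c2 rr) c1.
Qed.

End Components.

(** * The follower's tree *)

Section Game.
Local Open Scope ring_scope.

Lemma sum_mem_card (R : realType) (T : finType) (S E : {set T}) :
  \sum_(e in S) (e \in E)%:R = #|S :&: E|%:R :> R.
Proof.
rewrite -sum1_card natr_sum (big_setID E) /= addrC big1 ?add0r; last first.
  by move=> e; rewrite inE => /andP[/negPf->].
by apply: eq_bigr => e; rewrite inE => /andP[_ ->].
Qed.

Variables (R : realType) (a b : R) (lab : seq bool).
Hypotheses (ltab : a < b).
Notation n := (nV lab).
Notation V := 'I_n.
Implicit Types (F S A E : {set edge lab}) (p : edge lab -> R).

Lemma cardV : #|V| = n. Proof. exact: card_ord. Qed.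

Definition redA : {set edge lab} := [set e in pathE lab | ~~ nth false lab (val e.1)].

Lemma pathE_conn E : (forall e, e \in pathE lab -> conn E e.1 e.2) -> forall x y : V, conn E x y.
Proof.
move=> H; suff H0 x : conn E ord0 x.
  by move=> x y; apply: conn_trans (H0 y); rewrite connC.
case: x => k; elim: k => [|k IHk] ltk; first by rewrite (_ : Ordinal ltk = ord0) ?conn0 //; apply: val_inj.
apply: conn_trans (IHk (ltnW ltk)) _.
by apply: (H (Ordinal (ltnW ltk), Ordinal ltk)); rewrite inE /=.
Qed.

Lemma path_spanning E : pathE lab \subset E -> (ncomp E <= 1)%N.
Proof.
move=> /subsetP sE; apply: ncomp_connected; apply: pathE_conn => e eE.
exact/conn_edge/sE.
Qed.

Lemma spanningP F S : spanning_tree F S <->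
  [/\ S \subset pathE lab :|: F, #|S| = n.-1 & (ncomp S <= 1)%N].
Proof.
split=> -[sS cS H]; split=> //; first exact: ncomp_connected.
by move=> x y; apply: connected_ncomp.
Qed.

Lemma spanning_forest F S : spanning_tree F S -> forest S.
Proof.
move=> /spanningP[_ cS nS]; rewrite /forest eqn_leq card_ncomp andbT cS cardV.
exact: (leq_add nS (leqnn _)).
Qed.

Lemma follower_exists F p S0 : spanning_tree F S0 -> exists S, follower_choice a b F p S.
Proof.
move=> H0; pose P S := `[< spanning_tree F S >].
have P0 : P S0 by exact/asboolP.
case: (@arg_minP _ R _ S0 P (tree_weight a b p) P0) => S1 P1 min1.
pose Q S := P S && (tree_weight a b p S == tree_weight a b p S1).
have Q1 : Q S1 by rewrite /Q P1 eqxx.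
case: (@arg_maxP _ R _ S1 Q (revenue F p) Q1) => S /andP[/asboolP PS /eqP wS] max.
exists S; split=> // S' PS'; first by rewrite wS; apply: min1; exact/asboolP.
by move=> wS'; apply: max; rewrite /Q wS' wS eqxx andbT; exact/asboolP.
Qed.

(** Otherwise [exchange], applied to the tree edges no heavier than [e], would replace a strictly
    heavier edge by [e]. *)
Lemma mst_conn F p S e : follower_choice a b F p S -> e \in pathE lab ->
  conn [set f in S | weight_of a b p f <= weight_of a b p e] e.1 e.2.
Proof.
move=> [spS minS _] eP; set A := [set f in S | _]; apply/negPn/negP => ncA.
have /spanningP[sS cS nS] := spS.
have sAS : A \subset S by apply/subsetP => f; rewrite inE => /andP[].
have [f] := exchange sAS (connected_ncomp _ _ nS) ncA.
rewrite inE => /andP[fA fS] sub.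
have wf : weight_of a b p e < weight_of a b p f.
  by rewrite ltNge; apply: contra fA => we; rewrite inE fS.
have eS : e \notin S.
  by apply: contra ncA => eS; apply: conn_edge; rewrite inE eS lexx.
have : spanning_tree F (e |: S :\ f).
  apply/spanningP; split.
  - rewrite subUset sub1set inE eP /=; apply: subset_trans sS; exact: subsetDl.
  - by rewrite cardsU1 !inE (negPf eS) andbF -cS (cardsD1 f S) fS.
  - apply: ncomp_connected => x y; apply: sub; exact: connected_ncomp.
move/minS; rewrite /tree_weight big_setU1 ?inE ?(negPf eS) ?andbF //=.
by rewrite (big_setD1 f fS) /= lerD2r leNgt wf.
Qed.

(** By [mst_conn] the tree edges of weight at most [b] already connect the whole path, and a
    spanning tree has no edge to spare. *)
Lemma mst_le_b F p S : follower_choice a b F p S ->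
  forall e, e \in S -> weight_of a b p e <= b.
Proof.
move=> fc; have /spanningP[_ cS _] := let: And3 spS _ _ := fc in spS.
pose B := [set f in S | weight_of a b p f <= b].
have sBS : B \subset S by apply/subsetP => f; rewrite inE => /andP[].
have nB : (ncomp B <= 1)%N.
  apply: ncomp_connected; apply: pathE_conn => e eP.
  have := mst_conn fc eP; apply: conn_subset.
  apply/subsetP => f; rewrite !inE => /andP[-> /le_trans -> //].
  by rewrite /weight_of eP /red_cost; case: ifP => // _; exact: ltW.
have cB := card_ncomp B.
have BS : B = S.
  apply/eqP; rewrite eqEcard sBS cS -(leq_add2l 1).
  rewrite cardV in cB; exact: leq_trans cB (leq_add nB (leqnn _)).
by move=> e; rewrite -BS inE => /andP[].
Qed.

(** [A] is the part of the follower's tree of weight at most [a]: a blue edge in it earns at most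
    [a], any other at most [b] by [mst_le_b]. *)
Lemma revenue_upper F p v : valid_blue F -> leader_revenue a b lab F p v ->
  exists S A, [/\ A \subset S, S \subset pathE lab :|: F,
    (#|S| = n.-1 /\ #|A| + ncomp A = n)%N,
    A :&: pathE lab \subset redA /\ (forall e, e \in redA -> conn A e.1 e.2) &
    v <= a * #|A :\: pathE lab|%:R + b * #|(S :\: A) :\: pathE lab|%:R].
Proof.
move=> vF [S [fc ->]].
have spS : spanning_tree F S by case: fc.
have /spanningP[sS cS nS] := spS.
pose A := [set f in S | weight_of a b p f <= a].
have sAS : A \subset S by apply/subsetP => f; rewrite inE => /andP[].
exists S, A; split=> //.
- by split=> //; have /eqP := forest_sub (spanning_forest spS) sAS; rewrite cardV addnC.
- split.
    apply/subsetP => e; rewrite !inE => /andP[/andP[eS we] eP].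
    rewrite eP /=; move: we; rewrite /weight_of inE eP /red_cost; case: ifP => // _.
    by rewrite leNgt ltab.
  move=> e; rewrite !inE => /andP[eP el].
  have eP' : e \in pathE lab by rewrite inE.
  by have := mst_conn fc eP'; rewrite {2}/weight_of eP' /red_cost (negPf el).
rewrite /revenue.
have -> : A :\: pathE lab = S :&: (A :\: pathE lab).
  by rewrite setIDA (setIidPr sAS).
have -> : S :\: A :\: pathE lab = S :&: (S :\: A :\: pathE lab).
  by rewrite !setIDA setIid.
rewrite -!(@sum_mem_card R) !mulr_sumr -big_split /=.
rewrite [leRHS](big_setID F) /= [X in _ <= _ + X]big1 ?addr0; last first.
  move=> e; rewrite inE => /andP[eF eS].
  have := subsetP sS e eS; rewrite inE (negPf eF) orbF => eP.
  by rewrite ![_ \in _ :\: pathE lab]inE eP /= !mulr0 addr0.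
apply: ler_sum => e; rewrite inE => /andP[eS eF].
have [_ enP] := vF e eF.
rewrite !inE -[(_ == _)%N]/(_) eS /=.
have enP' : (val e.2 == (val e.1).+1)%N = false by apply/negbTE; move: enP; rewrite inE.
have pw : p e = weight_of a b p e by rewrite /weight_of (negPf enP).
rewrite enP' /= -pw; case: (lerP (p e) a) => pa /=; rewrite ?mulr0 ?mulr1 ?add0r ?addr0 //.
by rewrite pw; apply: mst_le_b fc _ eS.
Qed.

(** The tree of [kruskal3] is minimum and has the stated revenue; the follower's tie-breaking gives
    the leader no less. *)
Lemma revenue_lower F E1 p : valid_blue F -> E1 \subset F ->
  (forall e, e \in F -> p e = if e \in E1 then a else b) -> 0 <= a ->
  exists v, [/\ leader_revenue a b lab F p v, 0 <= v &
    v >= a * (rk E1)%:R + b * ((rk (E1 :|: redA :|: F))%:R - (rk (E1 :|: redA))%:R)].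
Proof.
move=> vF sE1 pE a0.
have b0 : 0 <= b by apply: le_trans (ltW ltab).
set E2 := E1 :|: redA; set E3 := E2 :|: F; pose E4 := pathE lab :|: F.
have sRP : redA \subset pathE lab by apply/subsetP => e; rewrite inE => /andP[].
have s12 : E1 \subset E2 by exact: subsetUl.
have s23 : E2 \subset E3 by exact: subsetUl.
have s34 : E3 \subset E4.
  rewrite /E3 /E2 !subUset subsetUr (subset_trans sE1 (subsetUr _ _)) andbT /=.
  exact: subset_trans sRP (subsetUl _ _).
have n4 : (ncomp E4 <= 1)%N by apply/path_spanning/subsetUl.
have [S0 [S0E f0 n0 [c1 c2 c3]]] := kruskal3 s12 s23 s34.
have sp0 : spanning_tree F S0.
  apply/spanningP; split; [exact: S0E | | by rewrite n0].
  move/eqP: f0; rewrite n0 cardV => f0.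
  have := ncomp_gt0 E4 (ord0 : V); move: n4 f0; clear.
  by case: (ncomp E4) => [|[|k]] // _ /(congr1 predn).
have FP e : e \in F -> e \notin pathE lab by case/vF.
(* Every edge weighs [a] or [b], so the weight depends only on the number of edges in [E2], those of
   weight [a]. *)
have weight S : spanning_tree F S ->
    tree_weight a b p S = b * n.-1%:R - (b - a) * #|S :&: E2|%:R.
  move=> /spanningP[sS cS _]; rewrite -cS -(@sum_mem_card R) -sum1_card natr_sum !mulr_sumr -sumrB.
  apply: eq_bigr => e eS; rewrite /weight_of.
  have := subsetP sS e eS; rewrite ![e \in _ :|: _]inE.
  case: ifP => [eP _|eP /= eF].
    have -> : e \in E1 = false.
      by apply/negbTE/negP => /(subsetP sE1)/FP; rewrite eP.
    rewrite /red_cost !inE in eP *; rewrite eP /=; case: (nth _ _ _) => /=; ring.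
  have -> : e \in redA = false.
    by apply/negbTE/negP => /(subsetP sRP); rewrite eP.
  by rewrite pE // orbF; case: (e \in E1) => /=; ring.
have [S fc] := follower_exists p sp0.
exists (revenue F p S); split.
- exact: (ex_intro _ S (conj fc erefl)).
- apply: sumr_ge0 => e; rewrite inE => /andP[_ /pE ->]; by case: ifP.
have [spS minS maxS] := fc.
have rev0 : revenue F p S0
    = a * #|S0 :&: E1|%:R + b * (#|S0 :&: E3|%:R - #|S0 :&: E2|%:R).
  rewrite -(sum_mem_card R S0 E1) -(sum_mem_card R S0 E2) -(sum_mem_card R S0 E3).
  rewrite -sumrB !mulr_sumr -big_split /= /revenue [RHS](big_setID F) /=.
  rewrite [X in _ = _ + X]big1 ?addr0.
    apply: eq_bigr => e; rewrite inE => /andP[eS eF].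
    have eR : (e \in redA) = false.
      by apply/negbTE/negP => /(subsetP sRP) eP; have := FP e eF; rewrite eP.
    rewrite (pE e eF) (in_setU e E2 F) (in_setU e E1 redA) eF eR !orbF orbT.
    by case: (e \in E1) => /=; ring.
  move=> e; rewrite inE => /andP[eF eS].
  have eE1 : (e \in E1) = false by apply/negbTE/negP => /(subsetP sE1) eF'; rewrite eF' in eF.
  by rewrite (in_setU e E2 F) (negPf eF) eE1 orbF subrr !mulr0 addr0.
rewrite -c1 -c2 -c3 -rev0.
apply: maxS; first exact: sp0.
apply/eqP; rewrite eq_le (minS _ sp0) andbT (weight _ sp0) (weight _ spS) lerD2l lerN2.
apply: ler_wpM2l; first by rewrite subr_ge0 ltW.
rewrite ler_nat c2 rkE.
have := forest_sub (spanning_forest spS) (subsetIl S E2).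
move=> /eqP; have := ncomp_subset (subsetIr S E2); clear.
move: (ncomp (S :&: E2)) (ncomp E2) #|S :&: E2| #|V| => *; lia.
Qed.

End Game.

(** * Components of the path *)

Section PathComponents.
Variable lab : seq bool.
Notation n := (size lab).+1.
Implicit Types (x y u v i j : nat).

(* [kap x] is the index of the [a]-component of vertex [x]; closing the last
   component by a fictitious [b]-edge makes [kap n] the number of components. *)
Definition kap x := count id (take x (rcons lab true)).

Definition nC := kap n.

Lemma kapS x : x < n -> kap x.+1 = kap x + nth true (rcons lab true) x.
Proof.
by move=> xn; rewrite /kap (take_nth true) ?size_rcons // -cats1 count_cat /= addn0.
Qed.

Lemma kap_red x : x < size lab -> kap x.+1 = kap x + nth false lab x.
Proof.
move=> xn; rewrite kapS 1?ltnW // nth_rcons xn; congr (_ + _).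
by rewrite (set_nth_default false).
Qed.

Lemma kap0 : kap 0 = 0. Proof. by rewrite /kap take0. Qed.

Lemma kap_mono x y : x <= y -> kap x <= kap y.
Proof.
move=> xy; rewrite /kap -(subnKC xy) takeD count_cat; exact: leq_addr.
Qed.

Lemma kap_lt x : x < n -> kap x < nC.
Proof.
move=> xn; apply: (@leq_ltn_trans (kap (size lab))); first exact: kap_mono.
by rewrite /nC kapS // nth_rcons ltnn eqxx addn1.
Qed.

Lemma nC_last : nC = (kap (size lab)).+1.
Proof. by rewrite /nC kapS // nth_rcons ltnn eqxx addn1. Qed.

Lemma nC_gt0 : 0 < nC. Proof. by apply: leq_ltn_trans (kap_lt (ltn0Sn _)). Qed.

(** First vertex of component [i]. For [i >= nC] the default of [find] gives [n], so [st i.+1] is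
    the end of component [i] even for the last one. *)
Definition st i := find (fun y => i <= kap y) (iota 0 n).

Lemma st_le i : st i <= n.
Proof. by rewrite /st -{2}(size_iota 0 n) find_size. Qed.

Lemma st_lt i y : y < n -> (y < st i) = (kap y < i).
Proof.
move=> yn; apply/idP/idP.
  move=> ys; have := before_find 0 ys; rewrite nth_iota // add0n => /negbT.
  by rewrite -ltnNge.
move=> ki; rewrite ltnNge; apply/negP => sy.
have h : has (fun y => i <= kap y) (iota 0 n).
  by rewrite has_find size_iota (leq_ltn_trans sy).
have := nth_find 0 h; rewrite -/(st i) nth_iota ?(leq_ltn_trans sy) // add0n => /leq_trans/(_ (kap_mono sy)).
by rewrite leqNgt ki.
Qed.

Lemma st_nC : st nC = n.
Proof.
apply/eqP; rewrite eqn_leq st_le; case: (leqP n (st nC)) => // H.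
by have := st_lt nC H; rewrite ltnn kap_lt.
Qed.

Lemma kap_st i : i < nC -> st i < n /\ kap (st i) = i.
Proof.
move=> iC; have sn : st i < n.
  by rewrite ltnNge; apply/negP => ns; have := @st_lt i (size lab) (ltnSn _);
     rewrite ns; have := kap_lt (ltnSn (size lab)); move: iC;
     rewrite /nC (kapS (ltnSn _)) nth_rcons ltnn eqxx addn1; lia.
split=> //; have := st_lt i sn; rewrite ltnn => /esym/negbT; rewrite -leqNgt => le.
apply/eqP; rewrite eqn_leq le andbT.
case E : (st i) sn le => [|s] sn le; first by rewrite kap0.
have := @st_lt i s (ltnW sn); rewrite E ltnSn => /esym ki.
by rewrite (kapS (ltnW sn)); move: ki; case: (nth _ _ _); rewrite /= ?addn0 ?addn1; lia.
Qed.

Lemma kapE x i : x < n -> (kap x == i) = (st i <= x < st i.+1).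
Proof. by move=> xn; rewrite st_lt // ltnS leqNgt st_lt // -leqNgt eqn_leq andbC. Qed.

Lemma st_kap x : x < n -> st (kap x) <= x < st (kap x).+1.
Proof. by move=> xn; rewrite -kapE. Qed.

Lemma st_ltS i : i < nC -> st i < st i.+1.
Proof. by move=> iC; have [sn ki] := kap_st iC; rewrite st_lt // ki. Qed.

Lemma st_mono i j : i <= j -> st i <= st j.
Proof.
move=> ij; rewrite leqNgt; apply/negP => H.
have sn : st j < n by apply: leq_trans H (st_le _).
have := H; rewrite st_lt // => H2; have := @st_lt j _ sn; rewrite ltnn; lia.
Qed.

Lemma st0 : st 0 = 0. Proof. by []. Qed.

Definition bad i := 1 < st i.+1 - st i < 4.
Lemma bad_size i : bad i -> 1 < st i.+1 - st i < 4.
Proof. by []. Qed.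

(** For a bad [i] this is its rank among the bad components, from 0; pairing goes by the parity of
    the rank. *)
Definition nb i := count bad (iota 0 i).
Definition nB := nb nC.

Lemma nbS i : nb i.+1 = nb i + bad i.
Proof. by rewrite /nb -addn1 iotaD count_cat /= addn0. Qed.

Lemma nb_mono i j : i <= j -> nb i <= nb j.
Proof. by move=> ij; rewrite /nb -(subnKC ij) iotaD count_cat; exact: leq_addr. Qed.

Lemma nb_lt i j : bad i -> i < j -> nb i < nb j.
Proof. by move=> bi ij; apply: leq_trans (nb_mono ij); rewrite nbS bi addn1. Qed.

Lemma nb_inj i j : bad i -> bad j -> nb i = nb j -> i = j.
Proof.
move=> bi bj E; case: (ltngtP i j) => // [/(nb_lt bi)|/(nb_lt bj)]; by rewrite E ltnn.
Qed.

Lemma nb_surj N k : k < nb N -> exists i, [/\ i < N, bad i & nb i = k].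
Proof.
elim: N => [|N IH]; first by rewrite /nb.
rewrite nbS; case bN : (bad N); rewrite /= ?addn0 ?addn1.
  rewrite ltnS leq_eqVlt => /predU1P[->|/IH[i [lt bi ki]]]; first by exists N.
  by exists i; split=> //; apply: ltnW.
by move=> /IH[i [lt bi ki]]; exists i; split=> //; apply: ltnW.
Qed.

Lemma nb_lt_nB i : bad i -> i < nC -> nb i < nB.
Proof. by move=> bi; apply: nb_lt. Qed.

Lemma nB_count : nB = count bad (iota 0 nC).
Proof. by []. Qed.

Definition lastbad i := bad i && ((nb i).+1 == nB).

Lemma lastbadE i : bad i -> lastbad i = ((nb i).+1 == nB).
Proof. by rewrite /lastbad => ->. Qed.

(* The bad components are paired in order: the first with the second, and so on. *)
Definition paired i j := [&& bad i, bad j, ~~ odd (nb i) & nb j == (nb i).+1].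

(* For an odd number of bad components, the last one, [B], joins the first
   component if the union spans four positions, otherwise the last component
   under the same condition; neither works only for short paths. *)
Definition leftover mu i j := has (fun B => lastbad B &&
  (if 4 <= st B.+1 then (i == 0) && (j == B)
   else if 4 <= n - st B then (i == B) && (j == nC.-1)
   else (mu == 3) && (4 <= n))) (iota 0 nC).

(** The pairs priced [a]. The mode [mu] will be 0 if [3a <= b] and 1 if [2a <= b < 3a]; for [b < 2a]
    it is 2 or 3 according to whether [3a <= 2b], a distinction that affects only the path b, a,
    b. *)
Definition low mu u v := [|| kap u == kap v,
  (0 < mu) && paired (kap u) (kap v) |
  [&& 1 < mu, odd nB & leftover mu (kap u) (kap v)]].

(** Odd ranks belong to second members of pairs, so this counts pairs. *)
Lemma count_odd N : count (fun i => bad i && odd (nb i)) (iota 0 N) = (nb N)./2.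
Proof.
elim: N => // N IH; rewrite -addn1 iotaD count_cat IH /= !addn0 add0n addn1 nbS.
case: (bad N) => /=; rewrite ?addn0 // addn1 -uphalfE uphalf_half addnC; lia.
Qed.

Lemma count_nb k N : count (fun i => bad i && ((nb i).+1 == k)) (iota 0 N) = (0 < k <= nb N).
Proof.
elim: N => [|N IH]; first by rewrite /nb /=; case: k.
rewrite -addn1 iotaD count_cat IH /= !addn0 add0n addn1 nbS.
case: (bad N) => /=; rewrite ?addn0 //; lia.
Qed.

Lemma count_lastbad : count lastbad (iota 0 nC) = (0 < nB).
Proof. by rewrite (count_nb nB nC) leqnn andbT. Qed.

Lemma lastbadP i : lastbad i -> bad i /\ nb i = nB.-1.
Proof. by case/andP=> bi /eqP <-. Qed.

Lemma lastbad_uniq i j : lastbad i -> lastbad j -> i = j.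
Proof. by move=> /lastbadP[bi ni] /lastbadP[bj nj]; apply: nb_inj => //; rewrite ni nj. Qed.

Lemma has_lastbad : 0 < nB -> exists2 i, i < nC & lastbad i.
Proof.
move=> nB0; have [|i [iC bi ni]] := @nb_surj nC nB.-1; first by rewrite -/nB; lia.
by exists i => //; rewrite /lastbad bi; lia.
Qed.

Lemma leftoverE mu i j B : lastbad B -> B < nC -> leftover mu i j =
  (if 4 <= st B.+1 then (i == 0) && (j == B)
   else if 4 <= n - st B then (i == B) && (j == nC.-1)
   else (mu == 3) && (4 <= n)).
Proof.
move=> lB BC; apply/hasP/idP => [[B' _ /andP[lB' H]]|H].
  by rewrite (lastbad_uniq lB lB').
by exists B; rewrite ?mem_iota // lB.
Qed.

End PathComponents.

(** * Bounds on the number of clusters *)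

Section Bounds.
Variable lab : seq bool.
Notation n := (size lab).+1.
Notation V := 'I_(nV lab).
Notation kap := (kap lab). Notation st := (st lab). Notation bad := (bad lab).
Notation nb := (nb lab). Notation nC := (nC lab). Notation nB := (nB lab).
Implicit Types (A E : {set edge lab}).

Definition stv i : V := inord (st i).

Lemma stvE i : i < nC -> stv i = st i :> nat.
Proof. by move=> iC; rewrite inordK //; have [] := kap_st iC. Qed.

Lemma conn_kap A (x y : V) : (forall e, e \in redA lab -> conn A e.1 e.2) ->
  kap x = kap y -> conn A x y.
Proof.
move=> HA; wlog xy : x y / x <= y.
  by move=> H; case: (leqP x y) => [/H //|/ltnW/H H'] /esym/H'; rewrite connC.
move=> E; have [k yk] : exists k, y = x + k :> nat by exists (y - x); rewrite subnKC.
elim: k y yk E xy => [|k IH] y yk E xy.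
  by have -> : x = y; [apply: val_inj; rewrite /= yk addn0 | exact: conn0].
have xkn : x + k < n by have := ltn_ord y; rewrite yk /nV; lia.
pose z : V := Ordinal xkn.
have kz : kap z = kap x.
  apply/eqP; rewrite eqn_leq (kap_mono lab (leq_addr k x : x <= z)) andbT.
  by rewrite E; apply: kap_mono; rewrite yk /=; lia.
apply: conn_trans (IH z erefl (esym kz) (leq_addr _ _)) _.
apply: (HA (z, y)); rewrite !inE /= yk addnS eqxx /=.
have zl : x + k < size lab by have := ltn_ord y; rewrite yk /nV; lia.
have := kap_red zl; rewrite -addnS -yk -E -kz.
by case: (nth false lab (x + k)) => //=; lia.
Qed.

Section Upper.
Variable A : {set edge lab}.
Hypotheses (blueA : forall e, e \in A -> (e \in pathE lab) || (e.1.+2 <= e.2))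
  (redsA : A :&: pathE lab \subset redA lab)
  (HA : forall e, e \in redA lab -> conn A e.1 e.2).

Lemma ncomp_le_nC : ncomp A <= nC.
Proof.
rewrite -(size_iota 0 nC) -(size_map stv); apply: ncomp_le_reps => x.
have kx : kap x < nC by apply: kap_lt.
exists (stv (kap x)); first by apply: map_f; rewrite mem_iota.
by apply: conn_kap => //; rewrite stvE //; have [_ ->] := kap_st kx.
Qed.

Let r := fingraph.root (adj A).
Let rho (i : 'I_nC) := r (stv i).

Lemma rootE (x y : V) : (r x == r y) = conn A x y.
Proof. exact: connRoot. Qed.

Lemma root_stv (x : V) : r (stv (kap x)) = r x.
Proof.
have kx : kap x < nC by apply: kap_lt.
by apply/eqP; rewrite rootE; apply: conn_kap => //; rewrite stvE //; have [_ ->] := kap_st kx.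
Qed.

Definition reds K := #|[set e in A :&: pathE lab | r e.1 == K]|.

(** Blue edges skip a position, so among two or three consecutive vertices none of them meets the
    second vertex [w]. A cluster consisting of this component alone must reach [w] by a red edge. *)
Lemma bad_alone (i0 : 'I_nC) : (forall i, rho i = rho i0 -> i = i0) -> bad i0 ->
  0 < reds (rho i0).
Proof.
move=> alone bi.
have ss := st_ltS (ltn_ord i0).
have s3 : (st i0).+1 < st i0.+1 <= (st i0).+3 by move: bi; rewrite /bad; lia.
have wn : (st i0).+1 < n by apply: leq_trans (st_le lab i0.+1); case/andP: s3.
pose w : V := Ordinal wn.
have inI (z : V) : r z = rho i0 -> st i0 <= z < st i0.+1.
  move=> rz; have kz : kap z < nC by apply: kap_lt.
  have := alone (Ordinal kz); rewrite /rho /= root_stv rz => /(_ erefl) E.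
  by rewrite -kapE //; apply/eqP; have := congr1 val E.
have rw : r w = rho i0.
  rewrite -root_stv /rho; congr (r (stv _)).
  by apply/eqP; rewrite kapE //=; lia.
have : conn A w (stv i0) by rewrite -rootE rw.
case/connectP=> [[|z p]] /=.
  by move=> _ E; have := congr1 val E; rewrite /= stvE //; lia.
case/andP=> wz _ _.
have rz : r z = rho i0 by rewrite -rw; apply/eqP; rewrite rootE connC; apply: connect1.
have := inI _ rz.
case/orP: wz => eA zI.
  have := blueA eA; case: (boolP (_ \in pathE lab)) => [eP _|_] /=; last by lia.
  by apply/card_gt0P; exists (w, z); rewrite !inE eA /= rw eqxx andbT; move: eP; rewrite inE.
have := blueA eA; case: (boolP (_ \in pathE lab)) => [eP _|_] /=; last by lia.
by apply/card_gt0P; exists (z, w); rewrite !inE eA /= rz eqxx andbT; move: eP; rewrite inE.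
Qed.

(** Summed over the clusters: one with [k >= 2] components has at most [k <= 2 (k - 1)] bad ones,
    and one that is a single bad component contains a red edge by [bad_alone]. *)
Lemma bad_bound : nB + 2 * ncomp A <= #|A :&: pathE lab| + 2 * nC.
Proof.
have rho_roots i : rho i \in roots (adj A) by exact: root_roots.
have nBE : nB = \sum_(K in roots (adj A)) \sum_(i | rho i == K) bad i.
  rewrite nB_count -sum1_count big_mkcond -{1}[nC]subn0 big_mkord.
  rewrite (eq_bigr (fun i : 'I_nC => nat_of_bool (bad i))); last by move=> i _; case: (bad i).
  rewrite (partition_big rho (mem (roots (adj A)))) => [|i _]; last exact: rho_roots.
  by apply: eq_bigr => K _; apply: eq_bigl.
have nCE : nC = \sum_(K in roots (adj A)) #|[set i | rho i == K]|.
  rewrite -{1}(card_ord nC) -sum1_card.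
  rewrite (partition_big rho (mem (roots (adj A)))) => [|i _]; last exact: rho_roots.
  by apply: eq_bigr => K _; rewrite -sum1_card; apply: eq_bigl => i; rewrite inE.
have rE : #|A :&: pathE lab| = \sum_(K in roots (adj A)) reds K.
  rewrite -sum1_card (partition_big (fun e : edge lab => r e.1) (mem (roots (adj A)))) /=; last first.
    by move=> e _; exact: root_roots.
  by apply: eq_bigr => K _; rewrite /reds -sum1_card; apply: eq_bigl => e; rewrite !inE.
have ncE : ncomp A = \sum_(K in roots (adj A)) 1 by rewrite sum1_card ncompE.
rewrite nBE rE ncE [in leqRHS]nCE !big_distrr /= -!big_split /=.
apply: leq_sum => K Kr; rewrite muln1.
set I := [set i | rho i == K].
have sumE : \sum_(i | rho i == K) bad i = \sum_(i in I) bad i.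
  by apply: eq_bigl => i; rewrite inE.
have sum_le : \sum_(i in I) bad i <= #|I|.
  by rewrite -sum1_card; apply: leq_sum => i _; case: (bad i).
have kK : kap K < nC by apply: kap_lt.
have rK : rho (Ordinal kK) = K by rewrite /rho /= root_stv; exact/eqP.
have I0 : 0 < #|I| by apply/card_gt0P; exists (Ordinal kK); rewrite inE rK.
rewrite sumE; case: (ltngtP #|I| 1) => [|I2|I1]; first by move: I0; case: #|I| => [|[]].
  by move: sum_le I2; clear; move: (\sum_(i in I) _) #|I| (reds K) => *; lia.
have /cards1P[i0 Ii] : #|I| == 1 by rewrite I1.
have ri0 : rho i0 = K by apply/eqP; have := set11 i0; rewrite -Ii inE.
rewrite Ii big_set1 cards1; case bi : (bad i0) => /=; last by lia.
have := bad_alone _ bi; rewrite ri0 => /(_ _)/= H.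
suff : 0 < reds K by lia.
by apply: H => i ri; apply/eqP; have : i \in I by [rewrite inE ri eqxx]; rewrite Ii inE.
Qed.

End Upper.

Section Lower.
Variable mu : nat.
Notation low := (low lab mu).

Definition blue : {set edge lab} := [set e : edge lab | e.1.+2 <= e.2].
Definition blue_low : {set edge lab} := [set e in blue | low e.1 e.2].

(* All of [K] is adjacent to its least vertex [x0], but for the successor of [x0], which is adjacent to [y]. *)
Lemma clique_conn E (K : pred V) (x0 y : V) : K x0 -> K y -> x0.+3 <= y ->
  (forall x, K x -> x0 <= x) ->
  (forall u v : V, K u -> K v -> u.+2 <= v -> (u, v) \in E) ->
  forall x, K x -> conn E x0 x.
Proof.
move=> K0 Ky y3 min cl x Kx; have := min x Kx.
have edge u v : K u -> K v -> u.+2 <= v -> conn E u v.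
  by move=> Ku Kv uv; apply: (conn_edge (e := (u, v))); apply: cl.
rewrite leq_eqVlt => /predU1P[E0|]; first by rewrite (val_inj E0) conn0.
rewrite leq_eqVlt => /predU1P[E1|]; last exact: edge.
apply: (conn_trans (edge _ _ K0 Ky _)); first by lia.
by rewrite connC; apply: edge => //; rewrite -E1.
Qed.

Lemma low_kap u v : kap u = kap v -> low u v.
Proof. by move=> E; rewrite /low E eqxx. Qed.

Lemma inst (x : V) i : (kap x == i) = (st i <= x < st i.+1).
Proof. exact: kapE. Qed.

Lemma comp_conn i : i < nC -> st i + 3 < st i.+1 ->
  forall x : V, kap x = i -> conn blue_low (stv i) x.
Proof.
move=> iC big x kx.
have yn : st i + 3 < n by apply: leq_trans big (st_le _ _).
apply: (@clique_conn _ (fun x : V => kap x == i) _ (Ordinal yn)); rewrite ?kx ?eqxx //.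
- by rewrite inst stvE //; lia.
- by rewrite inst /=; lia.
- by rewrite stvE //=; lia.
- by move=> z; rewrite inst stvE //; lia.
- by move=> u v /eqP ku /eqP kv uv; rewrite !inE /= uv low_kap ?ku ?kv.
Qed.

(** The components need not be neighbours: [clique_conn] only asks for a vertex at least three
    positions after the first one, here the last vertex of [j]. *)
Lemma two_comp_conn i j : i < j < nC -> st i + 3 < st j.+1 ->
  (forall u v : V, kap u = i -> kap v = j -> low u v) ->
  forall x : V, (kap x == i) || (kap x == j) -> conn blue_low (stv i) x.
Proof.
move=> /andP[ij jC] big lowij x kx.
have iC : i < nC by exact: ltn_trans jC.
have jn := st_le lab j.+1.
have jj := st_ltS jC; have ii := st_ltS iC.
have yn : (st j.+1).-1 < n by lia.
have mij := st_mono lab ij.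
apply: (@clique_conn _ (fun x : V => (kap x == i) || (kap x == j)) _ (Ordinal yn)) => //.
- by rewrite inst stvE //; lia.
- by rewrite !inst /=; lia.
- by rewrite stvE //=; lia.
- by move=> z; rewrite !inst stvE //; lia.
move=> u v ku kv uv; rewrite !inE /= uv.
case/orP: ku => /eqP ku; case/orP: kv => /eqP kv; last 1 first.
- by apply: low_kap; rewrite ku kv.
- by apply: low_kap; rewrite ku kv.
- exact: lowij.
- have := kap_mono lab (ltnW (ltnW uv)); rewrite ku kv; lia.
Qed.

(** [D] stands for the components absorbed by another one, [X] for the bad components left alone,
    whose isolated second vertex needs a representative of its own. *)
Lemma ncomp_le_count (D X : pred nat) :
  (forall i, i < nC -> D i -> exists j, [/\ j < nC, ~~ D j &
     forall x : V, kap x = i -> conn blue_low (stv j) x]) ->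
  (forall i, i < nC -> bad i -> ~~ D i -> ~~ X i ->
     forall x : V, kap x = i -> conn blue_low (stv i) x) ->
  ncomp blue_low <= count (predC D) (iota 0 nC) + count X (iota 0 nC).
Proof.
move=> HD HX.
set s := [seq stv i | i <- iota 0 nC & ~~ D i] ++ [seq inord (st i).+1 | i <- iota 0 nC & X i].
have -> : count (predC D) (iota 0 nC) + count X (iota 0 nC) = size s.
  by rewrite size_cat !size_map !size_filter.
apply: ncomp_le_reps => x.
have kx : kap x < nC by apply: kap_lt.
have sx : st (kap x) <= x < st (kap x).+1 by rewrite -inst.
have stvs j : j < nC -> ~~ D j -> stv j \in s.
  by move=> jC jD; rewrite mem_cat map_f // mem_filter jD mem_iota.
case Dx : (D (kap x)).
  have [j [jC jD H]] := HD _ kx Dx.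
  by exists (stv j); [exact: stvs | rewrite connC H].
have [big|small] := ltnP (st (kap x) + 3) (st (kap x).+1).
  by exists (stv (kap x)); [rewrite stvs ?Dx | rewrite connC comp_conn].
have [x0|x0] := eqVneq (x : nat) (st (kap x)).
  exists (stv (kap x)); first by rewrite stvs ?Dx.
  by rewrite (_ : stv _ = x) ?conn0 //; apply: val_inj; rewrite /= stvE.
have bx : bad (kap x) by rewrite /bad; lia.
case Xx : (X (kap x)); last first.
  by exists (stv (kap x)); [rewrite stvs ?Dx | rewrite connC HX ?Dx ?Xx].
have [x1|x1] := eqVneq (x : nat) (st (kap x)).+1.
  exists (inord (st (kap x)).+1).
    by rewrite mem_cat [X in _ || X]map_f ?orbT // mem_filter Xx mem_iota.
  by rewrite (_ : inord _ = x) ?conn0 //; apply: val_inj; rewrite -x1 inord_val.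
exists (stv (kap x)); first by rewrite stvs ?Dx.
rewrite connC; apply: (conn_edge (e := (stv (kap x), x))).
rewrite !inE /= stvE //; apply/andP; split; first by lia.
by apply: low_kap; have [_ ->] := kap_st kx.
Qed.

(** [code] names the cluster of a component; it is the invariant fed to [ncomp_ge_inj]. *)
Lemma ncomp_ge_count (D : pred nat) (code : nat -> nat) :
  (forall i j, i < nC -> j < nC -> ~~ D i -> ~~ D j -> code i = code j -> i = j) ->
  (forall u v : V, low u v -> code (kap u) = code (kap v)) ->
  count (predC D) (iota 0 nC) <= ncomp (blue_low :|: redA lab).
Proof.
move=> inj Hc; rewrite -size_filter -(size_map stv).
apply: (@ncomp_ge_inj _ _ _ (fun x : V => code (kap x))).
  move=> e; rewrite inE => /orP[]; rewrite !inE; first by case/andP=> _ /Hc.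
  case/andP=> /eqP E el; have lt : e.1 < size lab by rewrite -[_ < _]ltnS -E; exact: (ltn_ord e.2).
  by rewrite E kap_red // (negPf el) addn0.
rewrite -map_comp map_inj_in_uniq ?filter_uniq ?iota_uniq //.
move=> i j; rewrite !mem_filter !mem_iota /= add0n => /andP[iD iC] /andP[jD jC].
rewrite !stvE //; have [_ ->] := kap_st iC; have [_ ->] := kap_st jC; exact: inj.
Qed.

Lemma ncomp_all E : 3 < n -> blue \subset E -> ncomp E <= 1.
Proof.
move=> n4 /subsetP sE.
have n4' : 3 < nV lab by [].
have H x : conn E ord0 x.
  apply: (@clique_conn _ predT _ (Ordinal n4')) => // u v _ _ uv.
  by apply: sE; rewrite inE.
by apply: ncomp_connected => x y; apply: conn_trans (H y); rewrite connC.
Qed.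

End Lower.
End Bounds.

(** * Number of clusters in each mode *)

Section Cases.
Variable lab : seq bool.
Notation n := (size lab).+1.
Notation V := 'I_(nV lab).
Notation kap := (kap lab). Notation st := (st lab). Notation bad := (bad lab).
Notation nb := (nb lab). Notation nC := (nC lab). Notation nB := (nB lab).
Notation stv := (stv lab). Notation lastbad := (lastbad lab).

Lemma count_predC_iota (D : pred nat) : count (predC D) (iota 0 nC) = nC - count D (iota 0 nC).
Proof. by rewrite -[X in X - _](size_iota 0 nC) -(count_predC D) addKn. Qed.

Lemma ncomp_mode0 :
  nC <= ncomp (blue_low lab 0 :|: redA lab) /\ ncomp (blue_low lab 0) <= nC + nB.
Proof.
have c0 : count (predC pred0) (iota 0 nC) = nC by rewrite count_predC_iota count_pred0 subn0.
split.
  rewrite -{1}c0; apply: (@ncomp_ge_count _ _ pred0 id) => // u v.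
  by rewrite /low /= orbF => /eqP.
rewrite -[X in _ <= X + _]c0; apply: (@ncomp_le_count _ _ pred0 bad) => // i _ bi _; by rewrite bi.
Qed.

Lemma two_bad_span i j : i < j -> bad i -> bad j -> st i + 3 < st j.+1.
Proof.
move=> ij /bad_size bi /bad_size bj; have := st_mono lab (ij : i.+1 <= j); lia.
Qed.

Lemma nb_ltW i j : bad j -> nb i < nb j -> i < j.
Proof. by move=> bj lt; rewrite ltnNge; apply/negP => /(nb_mono lab); rewrite leqNgt lt. Qed.

(* A pair of bad components gets the code of its first member. *)
Definition code i := if bad i then (nb i)./2.*2 else i.*2.+1.

Lemma code_inj i j : ~~ (bad i && odd (nb i)) -> ~~ (bad j && odd (nb j)) ->
  code i = code j -> i = j.
Proof.
rewrite /code; case bi : (bad i); case bj : (bad j) => /= oi oj; try lia.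
by move=> E; apply: (@nb_inj lab) => //; lia.
Qed.

Lemma code_paired i j : paired lab i j -> code i = code j.
Proof. by case/and4P=> bi bj oi /eqP ej; rewrite /code bi bj ej; lia. Qed.

Lemma paired_prev i : bad i -> odd (nb i) -> exists2 j, j < i & paired lab j i.
Proof.
move=> bi oi; have [|j [ji bj nj]] := @nb_surj lab i (nb i).-1; first by lia.
by exists j => //; rewrite /paired bi bj nj; lia.
Qed.

Lemma paired_next i : i < nC -> bad i -> ~~ odd (nb i) -> ~~ lastbad i ->
  exists2 j, j < nC & paired lab i j.
Proof.
move=> iC bi oi; rewrite lastbadE // => nl; have lt := nb_lt_nB bi iC.
have [|j [jC bj nj]] := @nb_surj lab nC (nb i).+1; first by rewrite -/nB; lia.
by exists j => //; rewrite /paired bi bj nj; lia.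
Qed.

Section Paired.
Variable mu : nat.
Hypothesis mu0 : 0 < mu.

Lemma paired_conn i j : j < nC -> paired lab i j ->
  forall x : V, (kap x == i) || (kap x == j) -> conn (blue_low lab mu) (stv i) x.
Proof.
move=> jC /[dup] pij /and4P[bi bj oi /eqP ej].
have ij : i < j by apply: nb_ltW => //; rewrite ej.
apply: (@two_comp_conn _ _ i j); rewrite ?ij //; first exact: two_bad_span.
by move=> u v ku kv; rewrite /low ku kv mu0 pij orbT.
Qed.

(** Modes 2 and 3 are included when every bad component has a partner, since they then price as mode
    1 does. *)
Lemma ncomp_mode1 : (mu < 2) || ~~ odd nB ->
  nC - nB./2 <= ncomp (blue_low lab mu :|: redA lab) /\
  ncomp (blue_low lab mu) <= nC - nB./2 + odd nB.
Proof.
move=> nolast; pose D i := bad i && odd (nb i).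
have cD : count (predC D) (iota 0 nC) = nC - nB./2 by rewrite count_predC_iota count_odd.
rewrite -cD; split.
  apply: (@ncomp_ge_count _ _ D code) => [i j _ _|u v]; first exact: code_inj.
  case/or3P=> [/eqP -> //|/andP[_ /code_paired //]|/and3P[m1 o _]].
  by move: nolast; rewrite o; lia.
(* The unpaired bad component: the last one has even rank exactly when [nB] is odd. *)
pose X i := lastbad i && ~~ odd (nb i).
apply: leq_trans (_ : _ <= count (predC D) (iota 0 nC) + count X (iota 0 nC)) _.
  apply: ncomp_le_count => [i iC /andP[bi oi]|i iC bi].
    have [j ji pji] := paired_prev bi oi; exists j; split; first exact: ltn_trans ji iC.
      by case/and4P: pji => _ _ /negPf oj _; rewrite /D oj andbF.
    by move=> x kx; apply: paired_conn pji _ _ => //; rewrite kx eqxx orbT.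
  rewrite /D /X bi /= => oi; rewrite oi andbT => nl x kx.
  have [j jC pij] := paired_next iC bi oi nl.
  by apply: paired_conn pij _ _ => //; rewrite kx eqxx.
rewrite leq_add2l; case o : (odd nB).
  apply: leq_trans (_ : count lastbad (iota 0 nC) <= _); last by rewrite count_lastbad; lia.
  by apply: sub_count => i /andP[].
rewrite leqn0 -leqn0 leqNgt -has_count; apply/hasPn => i _.
rewrite /X negb_and negbK; case l : (lastbad i) => //=.
by case/andP: l => _ /eqP E; move: o; rewrite -E /=; case: odd.
Qed.

End Paired.

Section Leftover.
Variables (mu B : nat).
Hypotheses (mu1 : 1 < mu) (oB : odd nB) (BC : B < nC) (lB : lastbad B)
  (room : (3 < st B.+1) || (3 < n - st B)).

(* The component joined to the unpaired bad one. *)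
Let w := if 3 < st B.+1 then 0 else nC.-1.

Let wC : w < nC. Proof. by have := nC_gt0 lab; rewrite /w; case: ifP; lia. Qed.

Let badB : bad B. Proof. by case/lastbadP: lB. Qed.

Let nbB : (nb B).+1 = nB. Proof. by case/andP: lB => _ /eqP. Qed.

Let w_lastbad : lastbad w = false.
Proof.
apply/negbTE/negP => lw; have wB : w = B := lastbad_uniq lw lB.
have bB := bad_size badB; have C0 := nC_gt0 lab.
case: (boolP (3 < st B.+1)) => [wide|nwide].
  have B0 : B = 0 by rewrite -wB /w wide.
  by move: bB wide; rewrite B0 st0; lia.
have BE : B = nC.-1 by rewrite -wB /w (negPf nwide).
move: room bB; rewrite (negPf nwide) BE (prednK C0) st_nC /=; lia.
Qed.

(** Hence [w] is not absorbed as the second member of a pair and can represent the cluster that [B]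
    joins. *)
Let w_even : bad w && odd (nb w) = false.
Proof.
apply/negbTE/negP => /andP[bw ow].
have Bw : B <> w by move=> E; have := w_lastbad; rewrite -E lB.
case: (boolP (3 < st B.+1)) => [wide|nwide]; first by move: ow; rewrite /w wide.
have wE : w = nC.-1 by rewrite /w (negPf nwide).
have Bw' : B < w by have := wC; move: Bw; rewrite wE; move: BC; lia.
by have := nb_lt badB Bw'; have := nb_lt_nB bw wC; rewrite nbB; lia.
Qed.

Lemma leftover_conn : forall x : V, (kap x == B) || (kap x == w) -> conn (blue_low lab mu) (stv w) x.
Proof.
have bB := bad_size badB; have w0 := nC_gt0 lab.
have Bw : B <> w by move=> E; have := w_lastbad; rewrite -E lB.
have lowE u v : leftover lab mu (kap u) (kap v) -> low lab mu u v.
  by move=> l; rewrite /low mu1 oB l !orbT.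
case: (boolP (3 < st B.+1)) => [wide|nwide].
  have wE : w = 0 by rewrite /w wide.
  move=> x kx; rewrite wE; apply: (@two_comp_conn _ _ 0 B); rewrite ?st0 //; first by rewrite BC; lia.
    move=> u v ku kv; apply: lowE.
    by rewrite (leftoverE _ _ _ lB BC) wide ku kv !eqxx.
  by move: kx; rewrite wE orbC.
have wE : w = nC.-1 by rewrite /w (negPf nwide).
have tail : 3 < n - st B by move: room; rewrite (negPf nwide).
(* [two_comp_conn] starts from the lower component, here [B]; the base point is moved to [w]
   afterwards. *)
have H : forall x : V, (kap x == B) || (kap x == w) -> conn (blue_low lab mu) (stv B) x.
  apply: two_comp_conn; first by rewrite wC andbT wE; lia.
    by rewrite wE (prednK w0) st_nC; lia.
  move=> u v ku kv; apply: lowE.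
  by rewrite (leftoverE _ _ _ lB BC) (negPf nwide) tail ku kv wE !eqxx.
move=> x kx; apply: conn_trans (H x kx); rewrite connC; apply: H.
by rewrite stvE //; have [_ ->] := kap_st wC; rewrite eqxx orbT.
Qed.

Lemma ncomp_mode2 :
  nC - (nB./2).+1 <= ncomp (blue_low lab mu :|: redA lab) /\
  ncomp (blue_low lab mu) <= nC - (nB./2).+1.
Proof.
pose D i := (bad i && odd (nb i)) || lastbad i.
have disj i : bad i && odd (nb i) -> lastbad i = false.
  move=> /andP[bi oi]; apply/negbTE; rewrite lastbadE //.
  by apply/negP => /eqP E; move: oB; rewrite -E /= oi.
have cD : count (predC D) (iota 0 nC) = nC - (nB./2).+1.
  rewrite count_predC_iota; congr (_ - _).
  have := count_predUI (fun i => bad i && odd (nb i)) lastbad (iota 0 nC).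
  rewrite count_odd count_lastbad -/nB (_ : 0 < nB = true); last by case: (nB) oB.
  rewrite (@eq_count _ (predI _ _) pred0) ?count_pred0 ?addn0 ?addn1 //.
  by move=> i /=; case: (boolP (bad i && odd (nb i))) => // H; exact: disj.
have mu0 := ltnW mu1.
rewrite -cD; split.
  (* [w] may itself be the first member of a pair; the cluster then has three components, all with
     the code of [w]. *)
  pose code' i := if lastbad i then code w else code i.
  apply: (@ncomp_ge_count _ _ D code') => [i j _ _|u v].
    rewrite /D /code' !negb_or => /andP[oi /negPf ->] /andP[oj /negPf ->]; exact: code_inj.
  have ku : kap u < nC by apply: kap_lt.
  have kv : kap v < nC by apply: kap_lt.
  case/or3P=> [/eqP -> //|/andP[_ p]|/and3P[_ _]].
    case/and4P: (p) => bi bj oi /eqP ej.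
    have := nb_lt_nB bj kv; rewrite ej /code' !lastbadE // ej => lt.
    rewrite (_ : _ == nB = false); last by apply/negbTE; lia.
    rewrite (_ : _ == nB = false); first exact: code_paired.
    by apply/negP => /eqP E; move: oB; rewrite -E /=; rewrite negbK (negPf oi).
  have wl := w_lastbad; move: room wl; rewrite (leftoverE _ _ _ lB BC) /code' /w.
  case: ifP => [_ _ l0 /andP[/eqP -> /eqP ->]|_ /= -> l0 /andP[/eqP -> /eqP ->]].
    by rewrite l0 lB.
  by rewrite l0 lB.
apply: leq_trans (_ : _ <= count (predC D) (iota 0 nC) + count pred0 (iota 0 nC)) _; last first.
  by rewrite count_pred0 addn0.
apply: ncomp_le_count => [i iC /orP[/andP[bi oi]|li]|i iC bi].
- have [j ji pji] := paired_prev bi oi; exists j; split; first exact: ltn_trans ji iC.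
    case/and4P: pji => bj _ /negPf oj /eqP nj; rewrite /D oj andbF /= lastbadE // -nj.
    by have := nb_lt_nB bi iC; lia.
  by move=> x kx; apply: paired_conn pji _ _ => //; rewrite kx eqxx orbT.
- exists w; split; rewrite ?wC // /D ?w_even ?w_lastbad // => x kx.
  by apply: leftover_conn; rewrite kx (lastbad_uniq li lB) eqxx.
rewrite /D bi /= negb_or => /andP[oi nl] _ x kx.
have [j jC pij] := paired_next iC bi oi nl.
by apply: paired_conn pij _ _ => //; rewrite kx eqxx.
Qed.

End Leftover.
End Cases.

(** * Optimality of the clustered prices *)

Lemma ncomp_le_card (V : finType) (E : {set V * V}) : ncomp E <= #|V|.
Proof. by rewrite ncompE max_card. Qed.

Lemma conn_step (V : finType) (E : {set V * V}) x y :
  conn E x y -> x != y -> exists2 z, adj E x z & conn E x z.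
Proof.
case/connectP=> [[|z p]] /=; first by move=> _ ->; rewrite eqxx.
by case/andP=> xz _ _ _; exists z => //; apply: connect1.
Qed.

(** * Comparing the losses of a rival with those of the proposed prices *)

Section Arith.
Local Open Scope ring_scope.
Variables (R : realType) (a b : R) (n c r C m : nat).
Hypotheses (a0 : 0 <= a) (ab : a < b) (cC : (c <= C)%N) (mC : (m + 2 * c <= r + 2 * C)%N).

(** Bound for a rival with [c] clusters: [n - c] cheap tree edges, [r] of them red, and [c - 1]
    edges joining the clusters. Relative to [a (n - C) + b (C - 1)] it loses [b - a] for each of the
    [j = C - c] merges and [a] for each red edge. *)
Let U : R := a * (n%:R - c%:R - r%:R) + b * (c%:R - 1).

(** The loss [a m] is at most [a (r + 2 j)], and [2 a <= b - a]. *)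
Lemma arith0 : 3 * a <= b -> U <= a * (n%:R - (C + m)%:R) + b * (C%:R - 1).
Proof.
move=> h; pose j := (C - c)%N.
have E : C%:R = c%:R + j%:R :> R by rewrite -natrD subnKC.
have le : m%:R <= r%:R + 2 * j%:R :> R.
  by rewrite -natrM -natrD ler_nat /j; move: mC cC; lia.
have p1 : 0 <= (b - 3 * a) * j%:R by rewrite mulr_ge0 ?subr_ge0.
have p2 : 0 <= a * (r%:R + 2 * j%:R - m%:R) by rewrite mulr_ge0 ?subr_ge0.
rewrite /U natrD E; nra.
Qed.

(** The loss is [q (b - a) + a o]. If [j > q], one surplus merge pays for [a o]; if [j = q], then
    [r >= o]; if [j < q], each missing merge is paid for by two red edges, as [b - a <= 2 a]. *)
Lemma arith1 q (o : bool) : m = (q.*2 + o)%N -> (q <= C)%N -> b <= 3 * a -> (o -> 2 * a <= b) ->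
  U <= a * (n%:R - (C - q + o)%:R) + b * ((C - q)%:R - 1).
Proof.
move=> mE qC h1 h2; pose j := (C - c)%N.
have E : C%:R = c%:R + j%:R :> R by rewrite -natrD subnKC.
rewrite /U natrD natrB // E.
have r0 : 0 <= a * r%:R by rewrite mulr_ge0.
have [qj|jq] := leqP q j.
  have [k jE] : exists k, j = (q + k)%N by exists (j - q)%N; rewrite subnKC.
  have Ej : j%:R = q%:R + k%:R :> R by rewrite jE natrD.
  case: k jE Ej => [|k] jE Ej.
    have le : o%:R <= r%:R :> R by rewrite ler_nat; move: mC jE cC mE; rewrite /j -muln2; lia.
    have p2 : 0 <= a * (r%:R - o%:R) by rewrite mulr_ge0 ?subr_ge0.
    rewrite Ej; nra.
  have p1 : 0 <= (b - a) * k%:R by rewrite mulr_ge0 // subr_ge0 ltW.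
  have p2 : a * o%:R <= b - a.
    case: (o) h2 => [/(_ isT) h3|_]; first by rewrite mulr1 lerBrDr -mulr2n -mulr_natl.
    by rewrite mulr0 subr_ge0 ltW.
  rewrite Ej -[k.+1]addn1 natrD; nra.
have [k qE] : exists k, q = (j + k)%N by exists (q - j)%N; rewrite subnKC // ltnW.
have Eq : q%:R = j%:R + k%:R :> R by rewrite qE natrD.
have le : 2 * k%:R + o%:R <= r%:R :> R.
  by rewrite -natrM -natrD ler_nat; move: mC qE cC mE; rewrite /j -muln2; lia.
have p2 : 0 <= a * (r%:R - 2 * k%:R - o%:R) by rewrite mulr_ge0 //; lra.
have p1 : 0 <= (3 * a - b) * k%:R by rewrite mulr_ge0 // subr_ge0.
rewrite Eq; nra.
Qed.

(** With [k > 0] merges fewer than [q + 1] a rival has at least [2 k - 1 >= k] red edges, and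
    [b - a <= a]. *)
Lemma arith2 q : m = (q.*2.+1)%N -> (q < C)%N -> b <= 2 * a ->
  U <= a * (n%:R - (C - q.+1)%:R) + b * ((C - q.+1)%:R - 1).
Proof.
move=> mE qC h1; pose j := (C - c)%N.
have E : C%:R = c%:R + j%:R :> R by rewrite -natrD subnKC.
rewrite /U natrB // E.
have r0 : 0 <= a * r%:R by rewrite mulr_ge0.
have [qj|jq] := leqP q.+1 j.
  have [k jE] : exists k, j = (q.+1 + k)%N by exists (j - q.+1)%N; rewrite subnKC.
  have Ej : j%:R = q.+1%:R + k%:R :> R by rewrite jE natrD.
  have p1 : 0 <= (b - a) * k%:R by rewrite mulr_ge0 // subr_ge0 ltW.
  rewrite Ej; nra.
have [k qE] : exists k, q.+1 = (j + k)%N by exists (q.+1 - j)%N; rewrite subnKC // ltnW.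
have Eq : q.+1%:R = j%:R + k%:R :> R by rewrite qE natrD.
have le : k%:R <= r%:R :> R.
  by rewrite ler_nat; move: mC qE cC mE jq; rewrite /j -muln2; lia.
have p2 : 0 <= a * (r%:R - k%:R) by rewrite mulr_ge0 //; lra.
have p1 : 0 <= (2 * a - b) * k%:R by rewrite mulr_ge0 // subr_ge0.
rewrite Eq; nra.
Qed.

End Arith.

Section Optimal.
Local Open Scope ring_scope.
Variables (R : realType) (a b : R) (lab : seq bool).
Hypotheses (a0 : 0 <= a) (ab : a < b).
Notation n := (size lab).+1.
Notation V := 'I_(nV lab).
Notation kap := (kap lab). Notation st := (st lab). Notation bad := (bad lab).
Notation nC := (nC lab). Notation nB := (nB lab).
Notation blue := (blue lab).

Lemma blue_valid : valid_blue blue.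
Proof.
move=> e; rewrite !inE => h; split; first exact: ltnW.
by apply/eqP => E; rewrite E ltnn in h.
Qed.

Lemma valid_sub_blue (F : {set edge lab}) : valid_blue F -> F \subset blue.
Proof.
move=> vF; apply/subsetP => e /vF[lt]; rewrite !inE => ne.
by rewrite ltn_neqAle eq_sym ne.
Qed.

Variables (F' : {set edge lab}) (p' : edge lab -> R) (v' : R).
Hypotheses (vF' : valid_blue F') (lr' : leader_revenue a b lab F' p' v').

(* [x], [y] count the cheap and the expensive blue edges of the follower's tree. *)
Lemma rival : exists A : {set edge lab}, exists x y : nat,
  [/\ (x + #|A :&: pathE lab| + ncomp A = n)%N, (y < ncomp A <= nC)%N,
      (nB + 2 * ncomp A <= #|A :&: pathE lab| + 2 * nC)%N,
      (A \subset pathE lab :|: blue /\ forall e, e \in redA lab -> conn A e.1 e.2) &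
      (x + y <= #|blue|)%N /\ v' <= a * x%:R + b * y%:R].
Proof.
have [S [A [sAS sS [cS cA] [Ared Aconn] le]]] := revenue_upper ab vF' lr'.
have sF := valid_sub_blue vF'.
have sSb : S \subset pathE lab :|: blue by apply: subset_trans sS (setUS _ sF).
have Ab e : e \in A -> (e \in pathE lab) || (e.1.+2 <= e.2)%N.
  by move=> eA; have := subsetP sSb e (subsetP sAS e eA); rewrite in_setU [e \in blue]inE.
exists A, #|A :\: pathE lab|, #|(S :\: A) :\: pathE lab|; split.
- by rewrite [X in (X + _)%N]addnC cardsID.
- rewrite ncomp_le_nC // andbT.
  apply: leq_ltn_trans (subset_leq_card (subsetDl _ _)) _.
  rewrite cardsD (setIidPr sAS) cS; have := ncomp_gt0 A ord0.
  by move: cA; rewrite /nV; move: #|A| (ncomp A); clear => *; lia.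
- exact: bad_bound.
- by split=> //; apply: subset_trans sSb.
split=> //.
have -> : (#|A :\: pathE lab| + #|S :\: A :\: pathE lab| = #|S :\: pathE lab|)%N.
  rewrite -(cardsID A (S :\: pathE lab)); congr (_ + _)%N.
    apply: eq_card => e; rewrite !inE; case eA : (e \in A); rewrite ?andbF ?andbT //.
    by rewrite (subsetP sAS _ eA) andbT.
  by apply: eq_card => e; rewrite !inE; case: (e \in A); case: (e \in S); case: (_ == _).
apply: subset_leq_card; apply/subsetP => e; rewrite inE => /andP[eP eS].
by have := subsetP sSb e eS; rewrite in_setU (negPf eP).
Qed.

Lemma rival_bound : exists c r : nat, [/\ (c <= nC)%N, (nB + 2 * c <= r + 2 * nC)%N &
  v' <= a * (n%:R - c%:R - r%:R) + b * (c%:R - 1)].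
Proof.
have [A [x [y [cA /andP[yc cC] mC _ [_ le]]]]] := rival.
exists (ncomp A), #|A :&: pathE lab|; split=> //; apply: le_trans le _.
have -> : n%:R - (ncomp A)%:R - #|A :&: pathE lab|%:R = x%:R :> R.
  by rewrite -cA !natrD; ring.
rewrite lerD2l ler_wpM2l ?(le_trans a0 (ltW ab)) //.
by rewrite lerBrDr natr1 ler_nat.
Qed.

Variables (mu : 'I_4) (v : R).
Notation E1 := (blue_low lab mu).
Notation E2 := (E1 :|: redA lab).
Hypotheses
  (mode : [/\ ((mu == 0 :> nat) = (3 * a <= b)), ((1 < mu)%N -> b <= 2 * a),
     ((mu <= 1)%N -> (mu : nat) = 1%N -> 2 * a <= b) & ((mu : nat) = 2%N -> 3 * a <= 2 * b) /\
     ((mu : nat) = 3%N -> 2 * b <= 3 * a)])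
  (v0 : 0 <= v)
  (le_v : a * (rk E1)%:R + b * ((rk (E2 :|: blue))%:R - (rk E2)%:R) <= v).

Lemma rkR (E : {set edge lab}) : (rk E)%:R = n%:R - (ncomp E)%:R :> R.
Proof. by rewrite rkE natrB ?ncomp_le_card // card_ord. Qed.

Lemma rk_mono (E E' : {set edge lab}) : E \subset E' -> (rk E <= rk E')%N.
Proof. by move=> sE; rewrite !rkE leq_sub2l // ncomp_subset. Qed.

(** For [n > 3] the blue pairs alone connect all vertices, so every link between clusters can earn
    [b]. *)
Lemma optimal_large c1 c2 : (3 < n)%N -> (c2 <= ncomp E2)%N -> (ncomp E1 <= c1)%N ->
  a * (n%:R - c1%:R) + b * (c2%:R - 1) <= v.
Proof.
move=> n4 le2 le1; apply: le_trans le_v; rewrite !rkR.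
have le3 : (ncomp (E2 :|: blue) <= 1)%N by apply: ncomp_all => //; apply: subsetUr.
apply: lerD; first by rewrite ler_wpM2l // lerD2l lerN2 ler_nat.
rewrite ler_wpM2l ?(le_trans a0 (ltW ab)) //.
move: le2 le3; rewrite -(ler_nat R) -(ler_nat R (ncomp _)) => h1 h2; lra.
Qed.

Lemma nB_le_nC : (nB <= nC)%N.
Proof. by rewrite nB_count -[X in (_ <= X)%N](size_iota 0 nC) count_size. Qed.

Lemma low_small (x y : V) : (n <= 3)%N -> low lab mu x y -> kap x = kap y.
Proof.
move=> n3.
have kx : (kap x < nC)%N by apply: kap_lt.
have ky : (kap y < nC)%N by apply: kap_lt.
case/or3P=> [/eqP //|/andP[_ /and4P[bi bj _ /eqP ej]]|/and3P[_ _ /hasP[B _ /andP[lB]]]].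
  have ij : (kap x < kap y)%N by apply: (@nb_ltW lab) => //; rewrite ej.
  have := two_bad_span ij bi bj; have := st_le lab (kap y).+1; lia.
have [bB _] := lastbadP lB; have := st_le lab B.+1.
case: ifP => [h|_]; first by lia.
by case: ifP => [h|_]; [lia | move=> _ /andP[_ n4]; lia].
Qed.

Lemma card_blue_small : (n <= 3)%N -> (#|blue| <= (n == 3))%N.
Proof.
move=> n3; have [n3'|n3'] := eqVneq n 3.
  have H (e : edge lab) : e \in blue -> e.1 = 0 :> nat /\ e.2 = 2 :> nat.
    by rewrite inE; have := ltn_ord e.2; rewrite /nV; lia.
  apply/card_le1_eqP => -[x y] -[x' y'] /H[/= hx hy] /H[/= hx' hy'].
  by congr (_, _); apply: val_inj; rewrite /= ?hx ?hy ?hx' ?hy'.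
have n2 : (n <= 2)%N by rewrite -ltnS ltn_neqAle n3'.
rewrite leqn0 cards_eq0; apply/eqP/setP => e; rewrite !inE.
apply/negbTE; rewrite -ltnNge.
exact: leq_trans (ltn_ord e.2) (leq_trans n2 _).
Qed.

(** There is at most one blue pair, (0, 2) for [n = 3]. Within one component a rival gets at most
    [a] for it, otherwise at most [b], and that is its price here. *)
Lemma optimal_small : (n <= 3)%N -> v' <= v.
Proof.
move=> n3; have b0 : 0 <= b := le_trans a0 (ltW ab).
have [A [x [y [cA /andP[yc cC] _ _ [cxy le]]]]] := rival.
have := leq_trans cxy (card_blue_small n3).
have [n3'|_] := eqVneq n 3; last first.
  by case: x y le {cA yc cxy} => [|x] [|y] // le _; move: le; rewrite !mulr0 addr0 => /le_trans; apply.
move=> xy1.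
have lt0 : (0 < nV lab)%N by []. have lt2 : (2 < nV lab)%N by rewrite /nV n3'.
pose e : edge lab := (Ordinal lt0, Ordinal lt2).
have eb : e \in blue by rewrite inE.
have [k02|k02] := eqVneq (kap 0) (kap 2).
  have eE1 : e \in E1 by rewrite inE eb /= low_kap.
  have C1 : nC = 1%N.
    have sl : size lab = 2%N by case: n3'.
    by rewrite nC_last sl -k02 kap0.
  have y0 : y = 0%N by lia.
  rewrite y0 mulr0 addr0 in le; apply: le_trans le _; apply: le_trans le_v.
  have r1 : (0 < rk E1)%N.
    apply: leq_trans (rk_mono (_ : [set e] \subset E1)); last by rewrite sub1set.
    have nc : ~~ conn set0 e.1 e.2.
      apply/negP => /(@conn_const _ _ set0 id) H; have : e.1 = e.2 by apply: H => f; rewrite inE.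
      by move/(congr1 val).
    rewrite rkE -ncomp0 (ncomp_add_disc nc) setU0; lia.
  have h1 : x%:R <= (rk E1)%:R :> R by rewrite ler_nat; lia.
  apply: le_trans (ler_wpM2l a0 h1) _.
  by rewrite lerDl mulr_ge0 // subr_ge0 ler_nat rk_mono ?subsetUl.
have nc : ~~ conn E2 e.1 e.2.
  apply: contra k02 => /(@conn_const _ _ E2 (fun x : V => kap x)) H; apply/eqP; apply: H => f.
  rewrite inE => /orP[|]; rewrite !inE; first by case/andP=> _ /(low_small n3).
  case/andP=> /eqP E el; have lt : (f.1 < size lab)%N by rewrite -[(_ < _)%N]ltnS -E; exact: (ltn_ord f.2).
  by rewrite E kap_red // (negPf el) addn0.
have rk12 : (rk E2 < rk (E2 :|: blue))%N.
  apply: leq_trans (rk_mono (_ : e |: E2 \subset _)); last first.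
    by rewrite subUset sub1set in_setU eb orbT subsetUl.
  have := ncomp_le_card E2; rewrite !rkE (ncomp_add_disc nc).
  by move: #|V| (ncomp _); clear => *; lia.
apply: le_trans le _; apply: le_trans le_v.
have p3 : a * x%:R + b * y%:R <= b.
  have -> : a * x%:R + b * y%:R = b * (x + y)%:R - (b - a) * x%:R by rewrite natrD; ring.
  apply: (@le_trans _ _ (b * (x + y)%:R)).
    by rewrite gerBl mulr_ge0 // subr_ge0 ltW.
  by rewrite -[leRHS]mulr1 ler_wpM2l // (ler_nat R _ 1).
apply: le_trans p3 _; rewrite -[leLHS]add0r; apply: lerD; first by rewrite mulr_ge0.
by rewrite -[leLHS]mulr1 ler_wpM2l // lerBrDr addrC natr1 ler_nat.
Qed.

(* The path with labels [b, a, b]. *)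
Lemma optimal_bab B : (3 < n)%N -> (1 < mu)%N -> odd nB -> (B < nC)%N -> lastbad lab B ->
  (st B.+1 <= 3)%N -> (n - st B <= 3)%N -> v' <= v.
Proof.
move=> n4 mu1 oB BC lB w1 w2; have b0 : 0 <= b := le_trans a0 (ltW ab).
have [bB nbB] := lastbadP lB; have sB := bad_size bB.
have sB1 : st B = 1%N by lia. have sB3 : st B.+1 = 3 by lia.
have n4' : n = 4%N by lia.
have B1 : B = 1%N.
  have [sn kB] := kap_st BC; rewrite sB1 in kB.
  have B0 : B <> 0%N by move=> E; rewrite E in sB1.
  by have := kapS (ltn0Sn (size lab)); rewrite kB kap0; case: (nth _ _ _) => /=; lia.
have kapx k : (k < n)%N -> kap k = (if k < 1 then 0 else if k < 3 then 1 else 2)%N.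
  move=> kn; have := st_lt B kn; rewrite sB1 B1 => ->.
  have := st_lt B.+1 kn; rewrite sB3 B1 => ->.
  have k3 : (kap k <= 2)%N.
    have le3 : (k <= 3)%N by lia.
    apply: leq_trans (kap_mono lab le3) _.
    have l2 : (2 < n)%N by lia.
    have := kapS l2; have := st_lt B.+1 l2; rewrite sB3 B1 => /esym h.
    by case: (nth _ _ _) => /=; lia.
  by case: (kap k) k3 => [|[|[|]]].
have C3 : nC = 3%N by rewrite nC_last kapx // (_ : size lab = 3%N) //; lia.
have nB1 : nB = 1%N.
  have -> : nB = (nb lab B).+1 by case/andP: lB => _ /eqP.
  by rewrite B1 nbS; case b0' : (bad 0) => //; have := bad_size b0'; rewrite -[X in st X]B1 sB1 st0.
have wE i j : leftover lab mu i j = (mu == 3 :> nat).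
  rewrite (leftoverE _ _ _ lB BC) (_ : (3 < st B.+1)%N = false); last by lia.
  by rewrite (_ : (3 < n - st B)%N = false) ?n4 ?andbT //; lia.
(* In mode 2 no pair is cheap: the red [a]-edge stays and two blue edges earn [b]. In mode 3 all
   pairs are cheap and three of them form the tree. *)
have [o2 o3] : ((mu : nat) = 2 -> 2 * b <= v) /\ ((mu : nat) = 3 -> 3 * a <= v).
  split=> muE.
    have c2 : (3 <= ncomp E2)%N.
      rewrite -[X in (X <= _)%N]C3 -[X in (X <= _)%N](size_iota 0 nC) -(count_predT (iota 0 nC)).
      apply: (@ncomp_ge_count _ _ pred0 id) => // x y.
      case/or3P=> [/eqP //|/andP[_ /and4P[bi bj _ /eqP ej]]|]; last by rewrite wE muE !andbF.
      by have := nb_lt_nB bj (kap_lt (ltn_ord y)); rewrite ej nB1.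
    have le1 := ncomp_le_card E1; rewrite card_ord in le1.
    apply: le_trans (optimal_large n4 c2 le1); rewrite /nV; lra.
  have le1 : (ncomp E1 <= 1)%N.
    apply: ncomp_all => //; apply/subsetP => e eb; rewrite inE eb /=.
    by rewrite /low wE muE oB !orbT.
  by apply: le_trans (optimal_large n4 (ncomp_gt0 E2 ord0) le1); rewrite n4'; lra.
have [A [x [y [cA /andP[yc cC] _ [sA cnA] [_ le]]]]] := rival.
have mu23 : (mu : nat) = 2 \/ (mu : nat) = 3.
  by move: mu1 (ltn_ord mu); case: (nat_of_ord mu) => [|[|[|[|k]]]] // _ _; [left | right].
have [_ _ _ [m2 m3]] := mode.
have fin : v' <= 2 * b \/ v' <= 3 * a -> v' <= v.
  by case: mu23 => E; [have := o2 E; have := m2 E|have := o3 E; have := m3 E];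
     move=> ? ? [] ?; lra.
(* A red edge in [A] leaves at most two blue edges. Without one, cheap blue edges must join 1 to 2;
   the only blue partner of 1 is 3 and that of 2 is 0, so all four vertices form one cluster. *)
apply: fin; have [r0|r1] := posnP #|A :&: pathE lab|; last first.
  left; apply: le_trans le _.
  have h : (x + y <= 2)%N.
    move: cA yc r1 n4'; clear; move: #|_| (ncomp A) (size lab) => *; lia.
  have : x%:R + y%:R <= 2 :> R by rewrite -natrD ler_nat.
  have : 0 <= (b - a) * x%:R by rewrite mulr_ge0 // subr_ge0 ltW.
  nra.
right; have AP e : e \in A -> (e.1.+2 <= e.2)%N.
  move=> eA; have := subsetP sA e eA; rewrite in_setU [e \in blue]inE => /orP[eP|//].
  by have : e \in A :&: pathE lab by [rewrite inE eA]; rewrite (cards0_eq r0) inE.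
have lt k : (k < 4)%N -> (k < nV lab)%N by rewrite /nV n4'.
have z4 (z : V) : (z < 4)%N := leq_trans (ltn_ord z) (eq_leq n4').
pose w k (k4 : (k < 4)%N) : V := Ordinal (lt k k4).
pose w0 := w 0 isT; pose w1' := w 1%N isT; pose w2' := w 2 isT; pose w3 := w 3 isT.
have c12 : conn A w1' w2' by apply: conn_kap => //; rewrite !kapx.
have c13 : conn A w1' w3.
  have [z az cz] := conn_step c12 isT.
  suff <- : z = w3 by [].
  apply: val_inj; apply/eqP; rewrite eqn_leq -ltnS (z4 z).
  by case/orP: az => /AP.
have c20 : conn A w2' w0.
  have [|z az cz] := conn_step (_ : conn A w2' w1') isT; first by rewrite connC.
  suff <- : z = w0 by [].
  apply: val_inj; apply/eqP; rewrite -leqn0.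
  by case/orP: az => /AP //= h; have := leq_trans h (z4 z).
have cA1 : (ncomp A <= 1)%N.
  have H z : conn A w1' z.
    have [k [k4 ->]] : exists k (k4 : (k < 4)%N), z = w k k4.
      by exists z, (z4 z); apply: val_inj.
    case: k k4 => [|[|[|[|]]]] // k4; rewrite (bool_irrelevance k4 isT) //.
    - exact: conn_trans c12 c20.
    - exact: conn0.
  by apply: ncomp_connected => z z'; apply: conn_trans (H z'); rewrite connC.
have [y0 x3] : y = 0%N /\ x = 3%N.
  move: cA yc cA1 r0 n4'; clear; move: #|_| (ncomp A) (size lab) => *; lia.
by move: le; rewrite y0 x3 mulr0 addr0 mulrC.
Qed.

Theorem optimal : v' <= v.
Proof.
have [n3|n4] := leqP n 3; first exact: optimal_small.
have [c [r [cC mC le]]] := rival_bound.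
have [m0 m1 m1' _] := mode.
have qC := nB_le_nC.
have nBE : nB = ((nB./2).*2 + odd nB)%N by rewrite addnC odd_double_half.
have [mu0|mu0] := posnP mu.
  have := ncomp_mode0 lab; rewrite -mu0 => -[le2 le1].
  apply: le_trans (le_trans le _) (optimal_large n4 le2 le1); apply: arith0 => //.
  by rewrite -m0 mu0.
have b3 : b <= 3 * a by apply: ltW; rewrite ltNge -m0 -lt0n.
have [simple|] := boolP ((mu < 2)%N || ~~ odd nB).
  have [le2 le1] := ncomp_mode1 mu0 simple.
  apply: le_trans (le_trans le _) (optimal_large n4 le2 le1).
  apply: (@arith1 _ _ _ _ _ _ _ _ a0 ab cC mC _ _ nBE) => //.
    by apply: leq_trans qC; rewrite -divn2 leq_div.
  by move=> o; apply: m1'; move: simple mu0; rewrite o orbF; case: (nat_of_ord mu) => [|[]].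
rewrite negb_or negbK -leqNgt => /andP[mu2 oB].
have nB0 : (0 < nB)%N by case: (nB) oB.
have [B BC lB] := has_lastbad nB0.
have [room|] := boolP ((3 < st B.+1)%N || (3 < n - st B)%N); last first.
  by rewrite negb_or -!leqNgt => /andP[]; apply: optimal_bab.
have [le2 le1] := ncomp_mode2 mu2 oB BC lB room.
apply: le_trans (le_trans le _) (optimal_large n4 le2 le1).
apply: (@arith2 _ _ _ _ _ _ _ _ a0 ab cC mC) => //.
- by rewrite [LHS]nBE oB addn1.
- by apply: leq_trans qC; rewrite [X in (_ < X)%N]nBE oB addn1 ltnS -addnn leq_addr.
- exact: m1.
Qed.

End Optimal.

(** * The Turing machine *)

(* [W], [B], [C]: the three queries; [NU]: marking the next [u] and its first
   [v]; [P1]-[P4]: writing [u], then [v] and the price bit while the automaton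
   runs and the mark of [v] moves on; [F]: finding the mark of [u] at the end of
   a row; [Rw]: rewinding the work tape before the step named after it. *)
Inductive tag := Halt | Query | Yes | No
  | W0 | W1 | W2 | W3 | W4 | W5 | W6 | W7 | B1 | B2 | B3 | C1 | C2 | C3 | C4
  | Seek | Copy0 | Copy1 | Fin | RwPre | RwN | RwP1 | RwP2 | RwF
  | NU0 | NU1 | NU2 | NU3 | NU4 | NU5
  | P1a | P1b | P2a | P2b | P2c | P2d | P3a | P3b | P4 | Fa | Fb.

Definition tags := [:: Halt; Query; Yes; No;
  W0; W1; W2; W3; W4; W5; W6; W7; B1; B2; B3; C1; C2; C3; C4;
  Seek; Copy0; Copy1; Fin; RwPre; RwN; RwP1; RwP2; RwF;
  NU0; NU1; NU2; NU3; NU4; NU5;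
  P1a; P1b; P2a; P2b; P2c; P2d; P3a; P3b; P4; Fa; Fb].

Scheme Equality for tag.

Definition tag_code (t : tag) : 'I_(size tags) :=
  inord (find (tag_beq t) tags).

Definition tag_decode (i : 'I_(size tags)) : tag := nth Halt tags i.

Lemma tag_codeK : cancel tag_code tag_decode.
Proof. by case; rewrite /tag_decode /tag_code /= inordK. Qed.

HB.instance Definition _ := Finite.copy tag (can_type tag_codeK).

Definition active (t : tag) : bool := if t is (Halt | Query) then false else true.

Section Machine.
Variable Q : finType.
Variables (q0 : 'I_4 -> Q) (stp : Q -> bool -> bool -> bool -> Q) (out : Q -> bool).

Definition state := (tag * 'I_4 * Q * bool * bool)%type.

(** An [OTM] has a single halting, query, yes and no state, so the registers take fixed values there
    and cannot carry information through a query. *)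
Definition base (t : tag) (m : 'I_4) : state := (t, m, q0 ord0, false, false).

(* A vertex occupies two cells of the work tape, its label ([0]: an [a]-edge
   leaves it to the right, [1]: a [b]-edge, [#]: last vertex) and its mark
   ([0]: none, [1]: current [u], [#]: current [v]).  In a state, [e] and [o]
   remember of the label just read whether it ends a component, resp. whether
   the vertex is the last one.  The three oracle queries are told apart by the
   symbol under the work head: blank for [3a <= b], [1] for [3a <= a + b] and
   [#] for [3a <= 2b]; the number of negative answers is the mode [m]. *)
Definition delta (s : state) (h1 h2 : cell) : state * cell * cell * move * move :=
  let: (t, m, q, e, o) := s in
  let go t' w1 w2 d1 d2 := ((t', m, q, e, o), w1, w2, d1, d2) in
  let right t' := go t' h1 h2 Stay MoveR in
  let left t' := go t' h1 h2 Stay MoveL in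
  let write t' c := go t' h1 (Some c) Stay MoveR in
  let rewind t' := if h2 is None then right t' else left t in
  let halt := (base Halt ord0, h1, h2, Stay, Stay) in
  match t with
  | Halt | Query => halt
  | W0 => write W1 s1 | W1 => write W2 s1 | W2 => write W3 s1
  | W3 => write W4 sep | W4 => write W5 sep | W5 => right W6
  | W6 => write W7 sep | W7 => write Query s1
  | Yes => (base Seek (match h2 with None => inord 0 | Some (Some _) => inord 1 | Some None => inord 2 end),
            h1, h2, Stay, Stay)
  | No => match h2 with
          | None => left B1
          | Some (Some _) => go C1 h1 None Stay MoveR
          | Some None => (base Seek (inord 3), h1, h2, Stay, Stay)
          end
  | B1 => left B2 | B2 => left B3 | B3 => go Query h1 (Some s1) Stay Stay
  | C1 => right C2 | C2 => right C3 | C3 => go C4 h1 (Some s1) Stay MoveL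
  | C4 => left Query
  | Seek => right (if h2 is None then Copy0 else Seek)
  | Copy0 => if h1 is Some x then write Copy1 x else write Fin sep
  | Copy1 => go Copy0 None (Some s0) MoveR MoveR
  | Fin => write RwPre s0
  | RwPre => left RwN
  | RwN => rewind NU0
  | RwP1 => rewind P1a
  | RwP2 => if h2 is None then ((P2a, m, q0 m, e, o), h1, h2, Stay, MoveR) else left RwP2
  | RwF => rewind Fa
  | NU0 => right NU1
  | NU1 => write NU2 s1
  | NU2 => if h2 is None then halt else right NU3
  | NU3 => right NU4
  | NU4 => if h2 is None then halt else right NU5
  | NU5 => go RwP1 h1 (Some sep) Stay MoveL
  | P1a => right P1b
  | P1b => if h2 == Some s1 then go RwP2 (Some sep) h2 MoveR MoveL
           else go P1a (Some s1) h2 MoveR MoveR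
  | P2a => ((P2b, m, q, h2 != Some s0, h2 == Some sep), h1, h2, Stay, MoveR)
  | P2b => if h2 == Some sep then
             ((if o then P3a else P2c, m, stp q e false true, e, o),
              Some sep, Some s0, MoveR, MoveR)
           else ((P2a, m, stp q e (h2 == Some s1) false, e, o), Some s1, h2, MoveR, MoveR)
  | P2c => ((P2d, m, q, h2 != Some s0, false), h1, h2, Stay, MoveR)
  | P2d => ((P3a, m, stp q e false false, e, o), h1, Some sep, Stay, MoveR)
  | P3a => if h2 is None then go P4 (Some (Some (out q))) None MoveR MoveL
           else ((P3b, m, q, h2 != Some s0, o), h1, h2, Stay, MoveR)
  | P3b => ((P3a, m, stp q e false false, e, o), h1, h2, Stay, MoveR)
  | P4 => go (if o then RwF else RwP1) (Some sep) h2 MoveR MoveL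
  | Fa => right Fb
  | Fb => if h2 == Some s1 then go NU0 h1 (Some s0) Stay MoveR else right Fa
  end.

Definition machine : OTM :=
  {| tm_state := state; tm_start := base W0 ord0; tm_halt := base Halt ord0;
     tm_query := base Query ord0; tm_yes := base Yes ord0; tm_no := base No ord0;
     tm_delta := delta |}.

Variable orc : seq sym -> bool.
Notation step := (@tm_step machine orc).

Definition reach k (c c' : config machine) := exists2 t, t <= k & iter t step c = c'.

Lemma reach_refl c : reach 0 c c. Proof. by exists 0. Qed.

Lemma reach_le k k' c c' : k <= k' -> reach k c c' -> reach k' c c'.
Proof. by move=> le [t tk E]; exists t => //; apply: leq_trans le. Qed.

Lemma reach_trans c' k k' c c'' : reach k c c' -> reach k' c' c'' -> reach (k + k') c c''.
Proof.
move=> [t tk E] [t' tk' E']; exists (t' + t); first by rewrite addnC leq_add.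
by rewrite iterD E.
Qed.

Lemma reach2_trans c' k c c'' : reach 2 c c' -> reach k c' c'' -> reach k.+2 c c''.
Proof. by rewrite -add2n; exact: reach_trans. Qed.

Lemma reach1 c : reach 1 c (step c). Proof. by exists 1. Qed.

Lemma stepE t m q e o (t1 t2 : tape) : active t ->
  step ((t, m, q, e, o), t1, t2) =
  let: (s', w1, w2, d1, d2) := delta (t, m, q, e, o) (tape_head t1) (tape_head t2) in
  (s', tape_move d1 (tape_write w1 t1), tape_move d2 (tape_write w2 t2)).
Proof.
move=> at_; rewrite /tm_step /= /base !xpair_eqE.
by rewrite [t == Halt](introF eqP) 1?[t == Query](introF eqP) // => E; rewrite E in at_.
Qed.

(** [g] is the residue of the queries, behind the blank that stops rewinding; [z] stands for the
    erased input. *)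
Variable g z : seq cell.

(* Tape 1 with output [w], and the work tape with [u] left of the head and [v] from the head on. *)
Definition T1 (w : seq sym) : tape := (map Some (rev w) ++ z, None, [::]).

Definition T2 (u v : seq sym) : tape :=
  (map Some (rev u) ++ None :: g, head None (map Some v), behead (rcons (map Some v) None)).

Definition emit_cell (em : seq sym) : cell := if em is x :: _ then Some x else None.
Definition emit_move (em : seq sym) : move := if em is _ :: _ then MoveR else Stay.

Lemma T1_emit em w : size em <= 1 ->
  tape_move (emit_move em) (tape_write (emit_cell em) (T1 w)) = T1 (w ++ em).
Proof.
by case: em => [|x [|//]] _; rewrite /T1 /= ?cats0 // cats1 rev_rcons.
Qed.

Lemma stepR em c' t m q e o s' w u c v : active t -> size em <= 1 ->
  delta (t, m, q, e, o) None (Some c) = (s', emit_cell em, Some c', emit_move em, MoveR) ->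
  reach 1 ((t, m, q, e, o), T1 w, T2 u (c :: v)) (s', T1 (w ++ em), T2 (rcons u c') v).
Proof.
move=> tH em1 E; exists 1 => //.
rewrite /iter stepE // [tape_head (T1 w)]/= [tape_head (T2 _ _)]/= E T1_emit //.
by congr (_, _, _); rewrite /T2 rev_rcons /=; case: v.
Qed.

Lemma stepL em c' t m q e o s' w u d c v : active t -> size em <= 1 ->
  delta (t, m, q, e, o) None (Some c) = (s', emit_cell em, Some c', emit_move em, MoveL) ->
  reach 1 ((t, m, q, e, o), T1 w, T2 (rcons u d) (c :: v)) (s', T1 (w ++ em), T2 u (d :: c' :: v)).
Proof.
move=> tH em1 E; exists 1 => //.
rewrite /iter stepE // [tape_head (T1 w)]/= [tape_head (T2 _ _)]/= E T1_emit //.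
by congr (_, _, _); rewrite /T2 rev_rcons.
Qed.

Lemma stepEnd em t m q e o s' w u d : active t -> size em <= 1 ->
  delta (t, m, q, e, o) None None = (s', emit_cell em, None, emit_move em, MoveL) ->
  reach 1 ((t, m, q, e, o), T1 w, T2 (rcons u d) [::]) (s', T1 (w ++ em), T2 u [:: d]).
Proof.
move=> tH em1 E; exists 1 => //.
rewrite /iter stepE // [tape_head (T1 w)]/= [tape_head (T2 _ _)]/= E T1_emit //.
by congr (_, _, _); rewrite /T2 rev_rcons.
Qed.

(** With [v] empty the head would start on a blank and take it for the left end. *)
Lemma rewindP t m q e o s' w u v : active t -> 0 < size v ->
  (forall c, delta (t, m, q, e, o) None (Some c) = ((t, m, q, e, o), None, Some c, Stay, MoveL)) ->
  delta (t, m, q, e, o) None None = (s', None, None, Stay, MoveR) ->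
  reach (size u + 2) ((t, m, q, e, o), T1 w, T2 u v) (s', T1 w, T2 [::] (u ++ v)).
Proof.
move=> tH v0 dL dR; elim/last_ind: u v v0 => [|u d IH] [//|c v] _.
  exists 2 => //; rewrite /iter stepE // [tape_head (T1 w)]/= [tape_head (T2 _ _)]/= dL.
  rewrite stepE // [tape_head _]/= [tape_head (tape_move _ _)]/= dR.
  by congr (_, _, _).
rewrite size_rcons addSn -add1n.
have := IH (d :: c :: v) isT; rewrite -cat_rcons; apply: reach_trans.
by rewrite -{2}[w]cats0; apply: stepL.
Qed.

(* Unmarked vertices with labels [L]. *)
Definition bk (L : seq sym) : seq sym := flatten [seq [:: l; s0] | l <- L].

Lemma bk_cat L L' : bk (L ++ L') = bk L ++ bk L'. Proof. by rewrite /bk map_cat flatten_cat. Qed.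
Lemma bk_rcons L l : bk (rcons L l) = bk L ++ [:: l; s0]. Proof. by rewrite -cats1 bk_cat. Qed.
Lemma size_bk L : size (bk L) = (size L).*2.
Proof. by elim: L => //= l L ->. Qed.

Definition ends (l : sym) : bool := l != s0.
Definition qfold q L := foldl (fun q l => stp q (ends l) false false) q L.

Lemma stepRR em em' c c' t m q e o t' m' q' e' o' s' w u l d v :
  size em <= 1 -> size em' <= 1 ->
  delta (t, m, q, e, o) None (Some l) =
    ((t', m', q', e', o'), emit_cell em, Some c, emit_move em, MoveR) ->
  delta (t', m', q', e', o') None (Some d) = (s', emit_cell em', Some c', emit_move em', MoveR) ->
  active t -> active t' ->
  reach 2 ((t, m, q, e, o), T1 w, T2 u (l :: d :: v)) (s', T1 (w ++ em ++ em'), T2 (u ++ [:: c; c']) v).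
Proof.
move=> em1 em1' E E' tH tH'.
rewrite catA -cat_rcons cats1; apply: reach_trans (stepR w u (d :: v) tH em1 E) _.
exact: stepR.
Qed.

Lemma P1_loop m q e o w u L v :
  reach (size L).*2 ((P1a, m, q, e, o), T1 w, T2 u (bk L ++ v))
    ((P1a, m, q, e, o), T1 (w ++ nseq (size L) s1), T2 (u ++ bk L) v).
Proof.
elim: L w u => [|l L IH] w u; first by rewrite !cats0; exact: reach_refl.
have := IH (w ++ [:: s1]) (u ++ [:: l; s0]); rewrite -!catA [size (_ :: _)]/= doubleS; apply: reach2_trans.
by apply: (@stepRR [::] [:: s1]).
Qed.

Lemma P2_loop m q e o w u L v : exists e' o',
  reach (size L).*2 ((P2a, m, q, e, o), T1 w, T2 u (bk L ++ v))
    ((P2a, m, qfold q L, e', o'), T1 (w ++ nseq (size L) s1), T2 (u ++ bk L) v).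
Proof.
elim: L q e o w u => [|l L IH] q e o w u.
  by exists e, o; rewrite !cats0; exact: reach_refl.
have [e' [o' H]] := IH (stp q (ends l) false false) (ends l) (l == sep) (w ++ [:: s1]) (u ++ [:: l; s0]).
exists e', o'; move: H; rewrite -!catA [size (_ :: _)]/= doubleS; apply: reach2_trans.
by apply: (@stepRR [::] [:: s1]).
Qed.

Lemma P3_loop m q e o w u L : exists e',
  reach (size L).*2 ((P3a, m, q, e, o), T1 w, T2 u (bk L))
    ((P3a, m, qfold q L, e', o), T1 w, T2 (u ++ bk L) [::]).
Proof.
elim: L q e u => [|l L IH] q e u; first by exists e; rewrite !cats0; exact: reach_refl.
have [e' H] := IH (stp q (ends l) false false) (ends l) (u ++ [:: l; s0]).
exists e'; move: H; rewrite -!catA [size (_ :: _)]/= doubleS; apply: reach2_trans.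
by rewrite -{2}[w]cats0; apply: (@stepRR [::] [::]).
Qed.

Lemma F_loop m q e o w u L v :
  reach (size L).*2 ((Fa, m, q, e, o), T1 w, T2 u (bk L ++ v))
    ((Fa, m, q, e, o), T1 w, T2 (u ++ bk L) v).
Proof.
elim: L u => [|l L IH] u; first by rewrite !cats0; exact: reach_refl.
have := IH (u ++ [:: l; s0]); rewrite -!catA [size (_ :: _)]/= doubleS; apply: reach2_trans.
by rewrite -{2}[w]cats0; apply: (@stepRR [::] [::]).
Qed.

(* The pair of vertices with labels [lu], [lv] is current. *)
Definition marked L1 lu L2 lv L3 : seq sym :=
  bk L1 ++ [:: lu; s1] ++ bk L2 ++ [:: lv; sep] ++ bk L3.

Definition qpair m L1 lu L2 lv L3 : Q :=
  qfold (stp (qfold (stp (qfold (q0 m) L1) (ends lu) true false) L2) (ends lv) false true) L3.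

Definition triple m L1 lu L2 lv L3 : seq sym :=
  enc_triple (size L1, (size L1 + (size L2).+1)%N, out (qpair m L1 lu L2 lv L3)).

(** Both [u] and [v] are written in unary by counting vertices from the left end, hence two passes;
    the automaton runs during the second. The mark of [v] is erased on the way. *)
Lemma pass12 m q e o w L1 lu L2 lv v : exists e',
  reach (6 * (size L1 + size L2) + 20) ((P1a, m, q, e, o), T1 w,
      T2 [::] (bk L1 ++ [:: lu; s1] ++ bk L2 ++ [:: lv; sep] ++ v))
    ((if lv == sep then P3a else P2c, m,
      stp (qfold (stp (qfold (q0 m) L1) (ends lu) true false) L2) (ends lv) false true, e', lv == sep),
     T1 (w ++ enc_nat (size L1) ++ sep :: enc_nat (size L1 + (size L2).+1) ++ [:: sep]),
     T2 (bk L1 ++ [:: lu; s1] ++ bk L2 ++ [:: lv; s0]) v).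
Proof.
set r2 := [:: lv; sep] ++ v; set r1 := [:: lu; s1] ++ bk L2 ++ r2.
have H1 := P1_loop m q e o w [::] L1 r1.
set w1 := w ++ nseq (size L1) s1 in H1.
have H2 : reach 2 ((P1a, m, q, e, o), T1 w1, T2 (bk L1) r1)
   ((RwP2, m, q, e, o), T1 (w1 ++ [:: sep]), T2 (bk L1) r1).
  apply: (@reach_trans ((P1b, m, q, e, o), T1 w1, T2 (rcons (bk L1) lu) (s1 :: bk L2 ++ r2)) 1 1).
    by rewrite -[w1 in X in reach _ _ X]cats0; apply: (@stepR [::]).
  exact: (@stepL [:: sep]).
set w2 := w1 ++ [:: sep] in H2.
have H3 : reach (size (bk L1) + 2) ((RwP2, m, q, e, o), T1 w2, T2 (bk L1) r1)
   ((P2a, m, q0 m, e, o), T1 w2, T2 [::] (bk L1 ++ r1)).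
  exact: rewindP.
have [e4 [o4 H4]] := P2_loop m (q0 m) e o w2 [::] L1 r1.
set w4 := w2 ++ _ in H4; set q4 := qfold (q0 m) L1 in H4 *.
have H5 : reach 2 ((P2a, m, q4, e4, o4), T1 w4, T2 (bk L1) r1)
   ((P2a, m, stp q4 (ends lu) true false, ends lu, lu == sep), T1 (w4 ++ [:: s1]),
    T2 (bk L1 ++ [:: lu; s1]) (bk L2 ++ r2)).
  exact: (@stepRR [::] [:: s1]).
set w5 := w4 ++ [:: s1] in H5; set q5 := stp q4 _ _ _ in H5 *.
have [e6 [o6 H6]] := P2_loop m q5 (ends lu) (lu == sep) w5 (bk L1 ++ [:: lu; s1]) L2 r2.
set w6 := w5 ++ _ in H6; set q6 := qfold q5 L2 in H6 *.
exists (ends lv).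
have H7 : reach 2 ((P2a, m, q6, e6, o6), T1 w6, T2 ((bk L1 ++ [:: lu; s1]) ++ bk L2) r2)
   ((if lv == sep then P3a else P2c, m, stp q6 (ends lv) false true, ends lv, lv == sep),
    T1 (w6 ++ [:: sep]), T2 (((bk L1 ++ [:: lu; s1]) ++ bk L2) ++ [:: lv; s0]) v).
  exact: (@stepRR [::] [:: sep]).
have := reach_trans H1 (reach_trans H2 (reach_trans H3 (reach_trans H4 (reach_trans H5 (reach_trans H6 H7))))).
set w7 := w6 ++ _; 
have -> : w7 = w ++ enc_nat (size L1) ++ sep :: enc_nat (size L1 + (size L2).+1) ++ [:: sep].
  rewrite /w7 /w6 /w5 /w4 /w2 /w1 /enc_nat nseqD -!catA /=.
  by congr (_ ++ _); rewrite -!catA.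
rewrite -!catA.
apply: reach_le; rewrite size_bk; lia.
Qed.


Lemma finish m q e o w ws : 1 < size ws ->
  reach (size ws + 2) ((P3a, m, q, e, o), T1 w, T2 ws [::])
    ((if o then Fa else P1a, m, q, e, o), T1 (w ++ [:: Some (out q); sep]), T2 [::] ws).
Proof.
case/lastP: ws => // ws c; case/lastP: ws => // ws d _.
set f := Some (out q).
have H1 : reach 1 ((P3a, m, q, e, o), T1 w, T2 (rcons (rcons ws d) c) [::])
    ((P4, m, q, e, o), T1 (w ++ [:: f]), T2 (rcons ws d) [:: c]).
  exact: (@stepEnd [:: f]).
have H2 : reach 1 ((P4, m, q, e, o), T1 (w ++ [:: f]), T2 (rcons ws d) [:: c])
    ((if o then RwF else RwP1, m, q, e, o), T1 ((w ++ [:: f]) ++ [:: sep]), T2 ws [:: d; c]).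
  exact: (@stepL [:: sep]).
have H3 : reach (size ws + 2) ((if o then RwF else RwP1, m, q, e, o), T1 ((w ++ [:: f]) ++ [:: sep]), T2 ws [:: d; c])
    ((if o then Fa else P1a, m, q, e, o), T1 ((w ++ [:: f]) ++ [:: sep]), T2 [::] (ws ++ [:: d; c])).
  by case: (o); apply: rewindP.
have := reach_trans H1 (reach_trans H2 H3); rewrite -!cats1 -!catA.
by apply: reach_le; rewrite size_cat /=; lia.
Qed.

Lemma iter_next m q e o w L1 lu L2 lv l3 L3 : lv != sep -> exists q' e' o',
  reach (10 * (size L1 + size L2 + size L3) + 40)
    ((P1a, m, q, e, o), T1 w, T2 [::] (marked L1 lu L2 lv (l3 :: L3)))
    ((P1a, m, q', e', o'), T1 (w ++ triple m L1 lu L2 lv (l3 :: L3)),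
     T2 [::] (marked L1 lu (rcons L2 lv) l3 L3)).
Proof.
move=> /negPf lvs.
have [e1] := pass12 m q e o w L1 lu L2 lv (bk (l3 :: L3)); rewrite lvs.
set qa := stp _ (ends lv) _ _; set wa := w ++ _; set pre := bk L1 ++ [:: lu; s1] ++ bk L2 ++ [:: lv; s0] => H1.
have H2 : reach 2 ((P2c, m, qa, e1, false), T1 wa, T2 pre (bk (l3 :: L3)))
    ((P3a, m, stp qa (ends l3) false false, ends l3, false), T1 (wa ++ [::] ++ [::]),
     T2 (pre ++ [:: l3; sep]) (bk L3)).
  exact: (@stepRR [::] [::]).
rewrite !cats0 in H2.
have [e3 H3] := P3_loop m (stp qa (ends l3) false false) (ends l3) false wa (pre ++ [:: l3; sep]) L3.
have szp : size pre = (size L1 + size L2).*2 + 4.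
  by rewrite /pre !size_cat !size_bk /=; lia.
have := finish m (qfold (stp qa (ends l3) false false) L3) e3 false wa (ws := (pre ++ [:: l3; sep]) ++ bk L3).
case=> [|t tk H4]; first by rewrite !size_cat /=; lia.
exists (qfold (stp qa (ends l3) false false) L3), e3, false.
have := reach_trans H1 (reach_trans H2 (reach_trans H3 (ex_intro2 _ _ t tk H4))).
have -> : wa ++ [:: Some (out (qfold (stp qa (ends l3) false false) L3)); sep]
    = w ++ triple m L1 lu L2 lv (l3 :: L3).
  by rewrite /wa /triple /enc_triple -!catA /= -!catA.
have -> : (pre ++ [:: l3; sep]) ++ bk L3 = marked L1 lu (rcons L2 lv) l3 L3.
  by rewrite /pre /marked bk_rcons -!catA.
apply: reach_le; rewrite /marked !size_cat !size_bk /= size_rcons; lia.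
Qed.

Lemma iter_last m q e o w L1 lu L2 : exists q' e' o',
  reach (10 * (size L1 + size L2) + 40)
    ((P1a, m, q, e, o), T1 w, T2 [::] (marked L1 lu L2 sep [::]))
    ((Fa, m, q', e', o'), T1 (w ++ triple m L1 lu L2 sep [::]),
     T2 [::] (bk L1 ++ [:: lu; s1] ++ bk (rcons L2 sep))).
Proof.
have [e1] := pass12 m q e o w L1 lu L2 sep [::]; rewrite eqxx.
set qa := stp _ (ends sep) _ _; set wa := w ++ _; set pre := bk L1 ++ [:: lu; s1] ++ bk L2 ++ [:: sep; s0] => H1.
have szp : size pre = (size L1 + size L2).*2 + 4.
  by rewrite /pre !size_cat !size_bk /=; lia.
have := finish m qa e1 true wa (ws := pre); case=> [|t tk H2]; first by rewrite szp; lia.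
exists qa, e1, true.
have := reach_trans H1 (ex_intro2 _ _ t tk H2).
have -> : wa ++ [:: Some (out qa); sep] = w ++ triple m L1 lu L2 sep [::].
  by rewrite /wa /triple /enc_triple -!catA /= -!catA.
have -> : pre = bk L1 ++ [:: lu; s1] ++ bk (rcons L2 sep) by rewrite bk_rcons.
apply: reach_le; rewrite !size_cat !size_bk /= size_rcons; lia.
Qed.

Lemma next_u m q e o w L1 lu v :
  reach ((size L1).*2 + 2) ((Fa, m, q, e, o), T1 w, T2 [::] (bk L1 ++ [:: lu; s1] ++ v))
    ((NU0, m, q, e, o), T1 w, T2 (bk (rcons L1 lu)) v).
Proof.
have H1 := F_loop m q e o w [::] L1 ([:: lu; s1] ++ v).
apply: reach_trans H1 _; rewrite bk_rcons -[w in X in reach _ _ X]cats0.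
exact: (@stepRR [::] [::]).
Qed.

Lemma set_pair m q e o w L1 lu r lv L3 :
  reach ((size L1).*2 + 20) ((NU0, m, q, e, o), T1 w, T2 (bk L1) (bk [:: lu, r, lv & L3]))
    ((P1a, m, q, e, o), T1 w, T2 [::] (marked L1 lu [:: r] lv L3)).
Proof.
have H1 : reach 2 ((NU0, m, q, e, o), T1 w, T2 (bk L1) (bk [:: lu, r, lv & L3]))
    ((NU2, m, q, e, o), T1 (w ++ [::] ++ [::]), T2 (bk L1 ++ [:: lu; s1]) (bk [:: r, lv & L3])).
  exact: (@stepRR [::] [::]).
have H2 : reach 2 ((NU2, m, q, e, o), T1 w, T2 (bk L1 ++ [:: lu; s1]) (bk [:: r, lv & L3]))
    ((NU4, m, q, e, o), T1 (w ++ [::] ++ [::]), T2 ((bk L1 ++ [:: lu; s1]) ++ [:: r; s0]) (bk [:: lv & L3])).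
  exact: (@stepRR [::] [::]).
set u := (bk L1 ++ [:: lu; s1]) ++ [:: r; s0] in H2.
have H3 : reach 1 ((NU4, m, q, e, o), T1 w, T2 u (bk [:: lv & L3]))
    ((NU5, m, q, e, o), T1 (w ++ [::]), T2 (rcons u lv) (s0 :: bk L3)).
  exact: (@stepR [::]).
have H4 : reach 1 ((NU5, m, q, e, o), T1 w, T2 (rcons u lv) (s0 :: bk L3))
    ((RwP1, m, q, e, o), T1 (w ++ [::]), T2 u (lv :: sep :: bk L3)).
  exact: (@stepL [::]).
have H5 : reach (size u + 2) ((RwP1, m, q, e, o), T1 w, T2 u (lv :: sep :: bk L3))
    ((P1a, m, q, e, o), T1 w, T2 [::] (u ++ lv :: sep :: bk L3)).
  exact: rewindP.
rewrite !cats0 in H1 H2 H3 H4.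
have := reach_trans H1 (reach_trans H2 (reach_trans H3 (reach_trans H4 H5))).
rewrite /u /marked -!catA; apply: reach_le; rewrite !size_cat size_bk /=; lia.
Qed.

Definition halted (c : config machine) w := c.1.1 = base Halt ord0 /\ c.1.2 = T1 w.

Lemma no_pair m q e o w L1 lu R : size R < 2 -> exists2 c,
  reach 20 ((NU0, m, q, e, o), T1 w, T2 (bk L1) (bk (lu :: R))) c & halted c w.
Proof.
have H1 : reach 2 ((NU0, m, q, e, o), T1 w, T2 (bk L1) (bk (lu :: R)))
    ((NU2, m, q, e, o), T1 (w ++ [::] ++ [::]), T2 (bk L1 ++ [:: lu; s1]) (bk R)).
  exact: (@stepRR [::] [::]).
rewrite !cats0 in H1.
have Hend t u : t = NU2 \/ t = NU4 -> exists2 c,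
    reach 1 ((t, m, q, e, o), T1 w, T2 u [::]) c & halted c w.
  by case=> ->; eexists; try exact: reach1; rewrite stepE.
case: R H1 => [|r [|//]] H1 _.
  have [c H2 hc] := Hend NU2 (bk L1 ++ [:: lu; s1]) (or_introl (erefl _)).
  by exists c => //; apply: reach_le (reach_trans H1 H2).
have H2 : reach 2 ((NU2, m, q, e, o), T1 w, T2 (bk L1 ++ [:: lu; s1]) (bk [:: r]))
    ((NU4, m, q, e, o), T1 (w ++ [::] ++ [::]), T2 ((bk L1 ++ [:: lu; s1]) ++ [:: r; s0]) [::]).
  exact: (@stepRR [::] [::]).
rewrite !cats0 in H2.
have [c H3 hc] := Hend NU4 ((bk L1 ++ [:: lu; s1]) ++ [:: r; s0]) (or_intror (erefl _)).
by exists c => //; apply: reach_le (reach_trans H1 (reach_trans H2 H3)).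
Qed.

(** The automaton addressed by vertex numbers rather than by a splitting of the tape. *)
Fixpoint run (u v : nat) q x (L : seq sym) : Q :=
  if L is l :: L' then run u v (stp q (ends l) (x == u) (x == v)) x.+1 L' else q.

Lemma run_cat u v q x L L' : run u v q x (L ++ L') = run u v (run u v q x L) (x + size L) L'.
Proof. by elim: L q x => [|l L IH] q x; rewrite /= ?addn0 // IH addSnnS. Qed.

Lemma run_unmarked u v q x L :
  (forall k, k < size L -> (x + k != u) && (x + k != v)) -> run u v q x L = qfold q L.
Proof.
elim: L q x => //= l L IH q x H.
have /andP[/negPf xu /negPf xv] := H 0 isT; rewrite addn0 in xu xv.
by rewrite xu xv IH // => k kL; rewrite addSnnS H.
Qed.

Lemma qpairE m L1 lu L2 lv L3 :
  qpair m L1 lu L2 lv L3 =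
  run (size L1) (size L1 + (size L2).+1) (q0 m) 0 (L1 ++ lu :: L2 ++ lv :: L3).
Proof.
have e1 : (size L1 == size L1 + (size L2).+1) = false by apply/negbTE; lia.
have e2 : (size L1 + (size L2).+1 == size L1) = false by apply/negbTE; lia.
rewrite run_cat add0n [run _ _ _ _ (lu :: _)]/= eqxx e1 run_cat addSnnS.
rewrite [run _ _ _ _ (lv :: _)]/= eqxx e2 /qpair.
rewrite (@run_unmarked _ _ _ _ L1); last by move=> k kL; apply/andP; split; lia.
rewrite (@run_unmarked _ _ _ _ L2); last by move=> k kL; apply/andP; split; lia.
by rewrite (@run_unmarked _ _ _ _ L3) // => k kL; apply/andP; split; lia.
Qed.

Variables (m : 'I_4) (labs : seq sym).
Hypothesis labsP : forall X l Y, labs = X ++ l :: Y -> (l == sep) = (Y == [::]).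
Notation n := (size labs).

Definition flag u v : bool := out (run u v (q0 m) 0 labs).

Definition pair_out u v : seq sym := enc_triple (u, v, flag u v).

Definition row_out u v k : seq sym := flatten [seq pair_out u v | v <- iota v k].

Lemma tripleE L1 lu L2 lv L3 : labs = L1 ++ lu :: L2 ++ lv :: L3 ->
  triple m L1 lu L2 lv L3 = pair_out (size L1) (size L1 + (size L2).+1).
Proof. by move=> E; rewrite /triple /pair_out /flag qpairE E. Qed.

Lemma row_loop L1 lu L2 lv L3 q e o w : labs = L1 ++ lu :: L2 ++ lv :: L3 ->
  exists q' e' o', reach ((size L3).+1 * (10 * n + 40))
    ((P1a, m, q, e, o), T1 w, T2 [::] (marked L1 lu L2 lv L3))
    ((Fa, m, q', e', o'),
     T1 (w ++ row_out (size L1) (size L1 + (size L2).+1) (size L3).+1),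
     T2 [::] (bk L1 ++ [:: lu; s1] ++ bk (L2 ++ lv :: L3))).
Proof.
elim: L3 L2 lv q e o w => [|l3 L3 IH] L2 lv q e o w E.
  have /eqP lvs : lv == sep by rewrite (labsP (X := L1 ++ lu :: L2) (Y := [::])) // E -catA.
  rewrite {}lvs in E *.
  have [q' [e' [o' H]]] := iter_last m q e o w L1 lu L2.
  exists q', e', o'; rewrite cats1 /row_out /= cats0 -(tripleE E).
  by apply: reach_le H; rewrite E size_cat /= size_cat; lia.
have lvs : lv != sep by rewrite (labsP (X := L1 ++ lu :: L2) (Y := l3 :: L3)) // E -catA.
have [q1 [e1 [o1 H1]]] := iter_next m q e o w L1 lu L2 l3 L3 lvs.
have [|q' [e' [o' H]]] := IH (rcons L2 lv) l3 q1 e1 o1 (w ++ triple m L1 lu L2 lv (l3 :: L3)).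
  by rewrite cat_rcons.
rewrite (tripleE E) in H1 H; exists q', e', o'; have := reach_trans H1 H.
rewrite cat_rcons size_rcons -catA.
have -> : pair_out (size L1) (size L1 + (size L2).+1) ++
    row_out (size L1) (size L1 + (size L2).+2) (size L3).+1
    = row_out (size L1) (size L1 + (size L2).+1) (size (l3 :: L3)).+1.
  by rewrite (addnS _ (size L2).+1).
apply: reach_le.
by rewrite [leqRHS]mulSn leq_add2r E !size_cat /= !size_cat /=; lia.
Qed.

(** The machine halts at the first [u] with fewer than two vertices after it; the rows listed from
    there on are empty. *)
Lemma all_rows R L1 lu q e o w : labs = L1 ++ lu :: R -> exists2 c,
  reach ((size R).+1 * (n.+1 * (10 * n + 40)))
    ((NU0, m, q, e, o), T1 w, T2 (bk L1) (bk (lu :: R))) c &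
  halted c (w ++ flatten [seq row_out u u.+2 (n - u.+2) | u <- iota (size L1) (size R).+1]).
Proof.
elim: R L1 lu q e o w => [|r R IH] L1 lu q e o w E.
  have [c H hc] := no_pair m q e o w L1 lu (R := [::]) isT.
  exists c; first by apply: reach_le H; rewrite E size_cat /=; lia.
  by rewrite /= /row_out E size_cat /= addn1 (_ : _ - _ = 0) /= ?cats0 //; lia.
case: R IH E => [|lv L3] IH E.
  have [c H hc] := no_pair m q e o w L1 lu (R := [:: r]) isT.
  exists c; first by apply: reach_le H; rewrite E size_cat /=; lia.
  rewrite /= /row_out E size_cat /= addn2 subnn (_ : _ - _ = 0) /= ?cats0 //; lia.
have H1 := set_pair m q e o w L1 lu r lv L3.
have [q1 [e1 [o1 H2]]] := row_loop (L2 := [:: r]) q e o w E.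
have H3 := next_u m q1 e1 o1 (w ++ row_out (size L1) (size L1 + 2) (size L3).+1) L1 lu (bk [:: r, lv & L3]).
have [|c H4 hc] := IH (rcons L1 lu) r q1 e1 o1 (w ++ row_out (size L1) (size L1 + 2) (size L3).+1).
  by rewrite cat_rcons.
exists c.
  apply: reach_le (reach_trans H1 (reach_trans H2 (reach_trans H3 H4))).
  rewrite -[[:: r, lv & L3]]/([:: r; lv] ++ L3) [size (_ ++ _)]/=.
  have : (size L1).*2 + 20 + ((size L3).+1 * (10 * n + 40) + ((size L1).*2 + 2)) <= n.+1 * (10 * n + 40).
    rewrite [leqRHS](_ : _ = (size L3).+1 * (10 * n + 40) + (n - size L3) * (10 * n + 40)).
      have : 3 <= n - size L3 by rewrite E size_cat /=; lia.
      move=> le; have := leq_mul le (leqnn (10 * n + 40)).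
      have : size L1 <= n by rewrite E size_cat; lia.
      by rewrite -muln2; lia.
    rewrite -mulnDl; congr (_ * _); rewrite E size_cat /=; lia.
  set X := n.+1 * _; move: X (10 * n + 40) => X Y le.
  rewrite [leqRHS]mulSn; move: (_ * X) => Z; lia.
move: hc; rewrite -catA size_rcons /=; congr (halted c (w ++ _ ++ _)).
by rewrite addn2 E size_cat /=; congr row_out; lia.
Qed.

End Machine.

(** * Queries, copying of the input, and the total running time *)

Section Start.
Variable Q : finType.
Variables (q0 : 'I_4 -> Q) (stp : Q -> bool -> bool -> bool -> Q) (out : Q -> bool).
Variable orc : seq sym -> bool.
Notation M := (machine q0 stp out).
Notation step := (@tm_step M orc).
Notation reach := (@reach Q q0 stp out orc).
Notation base := (base q0).

Lemma reach_step c c' k c'' : step c = c' -> reach k c' c'' -> reach k.+1 c c''.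
Proof. by move=> <- [t tk E]; exists t.+1; rewrite ?iterSr. Qed.

Lemma step_query t1 t2 : step (base Query ord0, t1, t2) =
  ((if orc (tape_word t2) then base Yes ord0 else base No ord0), t1, t2).
Proof.
by rewrite /tm_step /= eqxx; case: eqP.
Qed.

(** [2a <= b] is asked as [3a <= a + b]: with a common left-hand side the three query words differ
    only at their right end. *)
Definition mode : 'I_4 :=
  if orc (enc_query 3 0 0 1) then inord 0 else
  if orc (enc_query 3 0 1 1) then inord 1 else
  if orc (enc_query 3 0 0 2) then inord 2 else inord 3.

(** The blank skipped in state [W5] is ignored by [tape_word] and reserves a cell: filling it gives
    the second query, clearing it and appending a [1] the third. *)
Lemma query_phase t1 : exists g,
  reach 60 (base W0 ord0, t1, blank_tape) (base Copy0 mode, t1, T2 g [::] [::]).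
Proof.
case: t1 => [[l c] r].
pose t1 : tape := (l, c, r); rewrite -/t1.
pose tA : tape := ([:: Some s1; Some sep; None; Some sep; Some sep; Some s1; Some s1; Some s1], None, [::]).
pose tB : tape := ([:: Some sep; Some sep; Some s1; Some s1; Some s1], Some s1, [:: Some sep; Some s1; None]).
pose tC : tape := ([:: None; Some sep; Some sep; Some s1; Some s1; Some s1], Some sep, [:: Some s1; Some s1]).
have HA : reach 8 (base W0 ord0, t1, blank_tape) (base Query ord0, t1, tA).
  by do 8 (apply: reach_step; first by rewrite stepE); exact: reach_refl.
have HAB : reach 4 (base No ord0, t1, tA) (base Query ord0, t1, tB).
  by do 4 (apply: reach_step; first by rewrite stepE); exact: reach_refl.
have HBC : reach 5 (base No ord0, t1, tB) (base Query ord0, t1, tC).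
  by do 5 (apply: reach_step; first by rewrite stepE); exact: reach_refl.
have qA := step_query t1 tA; have qB := step_query t1 tB; have qC := step_query t1 tC.
rewrite [tape_word _]/(enc_query 3 0 0 1) in qA.
rewrite [tape_word _]/(enc_query 3 0 1 1) in qB.
rewrite [tape_word _]/(enc_query 3 0 0 2) in qC.
rewrite /mode; case: ifP => oA; rewrite oA in qA.
  eexists; apply: reach_le (reach_trans HA _); last first.
    apply: reach_step qA _; apply: reach_step; first by rewrite stepE.
    by apply: reach_step; first (by rewrite stepE); exact: reach_refl.
  by [].
have {}HAB := reach_trans HA (reach_step qA HAB).
case: ifP => oB; rewrite oB in qB.
  eexists; apply: reach_le (reach_trans HAB _); last first.
    apply: reach_step qB _; apply: reach_step; first by rewrite stepE.
    by do 4 (apply: reach_step; first (by rewrite stepE)); exact: reach_refl.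
  by [].
have {}HBC := reach_trans HAB (reach_step qB HBC).
case: ifP => oC; rewrite oC in qC.
all: eexists; apply: reach_le (reach_trans HBC _); last first.
1,3: apply: reach_step qC _; apply: reach_step; first by rewrite stepE.
1,2: by do 4 (apply: reach_step; first (by rewrite stepE)); exact: reach_refl.
all: by [].
Qed.

(* Tape 1 with the part [s] of the input still to be read. *)
Definition TI (z : seq cell) (s : seq sym) : tape :=
  (z, head None (map Some s), behead (map Some s)).

Lemma stepA em c' g z t m q e o s' w u : active t -> size em <= 1 ->
  delta q0 stp out (t, m, q, e, o) None None = (s', emit_cell em, Some c', emit_move em, MoveR) ->
  reach 1 ((t, m, q, e, o), T1 z w, T2 g u [::]) (s', T1 z (w ++ em), T2 g (rcons u c') [::]).
Proof.
move=> tH em1 E; exists 1 => //.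
rewrite /iter stepE // [tape_head (T1 z w)]/= [tape_head (T2 _ _ _)]/= E T1_emit //.
by congr (_, _, _); rewrite /T2 rev_rcons.
Qed.

Lemma copy_loop g z m q e o u s :
  reach (size s).*2 ((Copy0, m, q, e, o), TI z s, T2 g u [::])
    ((Copy0, m, q, e, o), TI (nseq (size s) None ++ z) [::], T2 g (u ++ bk s) [::]).
Proof.
elim: s z u => [|x s IH] z u; first by rewrite cats0; exact: reach_refl.
have := IH (None :: z) (u ++ [:: x; s0]); rewrite -catA.
have -> : nseq (size s) None ++ None :: z = nseq (size (x :: s)) None ++ z.
  by rewrite /=; elim: (size s) => //= k ->.
have S1 : step ((Copy0, m, q, e, o), TI z (x :: s), T2 g u [::]) =
    ((Copy1, m, q, e, o), TI z (x :: s), T2 g (rcons u x) [::]).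
  by rewrite stepE // /T2 rev_rcons.
have S2 : step ((Copy1, m, q, e, o), TI z (x :: s), T2 g (rcons u x) [::]) =
    ((Copy0, m, q, e, o), TI (None :: z) s, T2 g (u ++ [:: x; s0]) [::]).
  by rewrite stepE // -cat_rcons cats1 /T2 !rev_rcons; case: (s).
by rewrite [size (_ :: _)]/= doubleS => H; apply: reach_step S1 (reach_step S2 H).
Qed.

Lemma start_phase g m q e o s :
  reach (4 * size s + 8) ((Copy0, m, q, e, o), tape_of s, T2 g [::] [::])
    ((NU0, m, q, e, o), T1 (nseq (size s) None) [::], T2 g [::] (bk (rcons s sep))).
Proof.
have -> : tape_of s = TI [::] s by case: s.
have H1 := copy_loop g [::] m q e o [::] s; rewrite cats0 in H1.
set z := nseq _ _ in H1 *.
have H2 : reach 1 ((Copy0, m, q, e, o), T1 z [::], T2 g (bk s) [::])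
   ((Fin, m, q, e, o), T1 z ([::] ++ [::]), T2 g (rcons (bk s) sep) [::]).
  exact: (@stepA [::]).
have H3 : reach 1 ((Fin, m, q, e, o), T1 z [::], T2 g (rcons (bk s) sep) [::])
   ((RwPre, m, q, e, o), T1 z ([::] ++ [::]), T2 g (rcons (rcons (bk s) sep) s0) [::]).
  exact: (@stepA [::]).
have H4 : reach 1 ((RwPre, m, q, e, o), T1 z [::], T2 g (rcons (rcons (bk s) sep) s0) [::])
   ((RwN, m, q, e, o), T1 z ([::] ++ [::]), T2 g (rcons (bk s) sep) [:: s0]).
  exact: (@stepEnd _ _ _ _ _ _ _ [::]).
have H5 : reach (size (rcons (bk s) sep) + 2) ((RwN, m, q, e, o), T1 z [::], T2 g (rcons (bk s) sep) [:: s0])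
   ((NU0, m, q, e, o), T1 z [::], T2 g [::] (rcons (bk s) sep ++ [:: s0])).
  exact: rewindP.
have := reach_trans H1 (reach_trans H2 (reach_trans H3 (reach_trans H4 H5))).
rewrite bk_rcons cat_rcons; apply: reach_le; rewrite size_rcons size_bk; lia.
Qed.

Lemma T1_word k w : tape_word (T1 (nseq k None) w) = w.
Proof.
rewrite /tape_word /T1 rev_cat map_rev revK -catA pmap_cat.
have -> : pmap id (rev (nseq k (None : cell))) = [::].
  by rewrite rev_nseq; elim: k.
rewrite /= pmap_cat /= cats0; elim: w => //= x w ->; by [].
Qed.

Definition flags (lab : seq bool) u v : bool :=
  flag q0 stp out mode (rcons (map Some lab) None) u v.

Definition pairs (lab : seq bool) : seq (nat * nat * bool) :=
  flatten [seq [seq (u, v, flags lab u v) | v <- iota u.+2 ((size lab).+1 - u.+2)]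
          | u <- iota 0 (size lab).+1].

Lemma enc_output_cat L L' : enc_output (L ++ L') = enc_output L ++ enc_output L'.
Proof. by rewrite /enc_output map_cat flatten_cat. Qed.

Lemma machine_computes lab :
  tm_computes M orc (enc_input lab) (200 * (size lab).+1 ^ 4) (enc_output (pairs lab)).
Proof.
set n := (size lab).+1.
have [g H1] := query_phase (tape_of (enc_input lab)).
have H2 := start_phase g mode (q0 ord0) false false (enc_input lab).
set labs := rcons (map Some lab) sep.
have labsP X l Y : labs = X ++ l :: Y -> (l == sep) = (Y == [::]).
  rewrite /labs; case/lastP: Y => [|Y y].
    by rewrite cats1 => /rcons_inj[_ <-].
  rewrite -rcons_cons -rcons_cat => /rcons_inj[E _].
  have : l \in map Some lab by rewrite E mem_cat inE eqxx orbT.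
  by case/mapP=> x _ ->; case: Y {E}.
have szl : size labs = n by rewrite size_rcons size_map.
have [l0 [R E]] : exists l0 R, labs = l0 :: R.
  by case: (labs) szl => // l0 R _; exists l0, R.
have [c [t tk Et] [hc1 hc2]] := @all_rows _ q0 stp out orc g (nseq (size lab) None) mode labs labsP R [::] l0
  (q0 ord0) false false [::] E.
have szR : (size R).+1 = n by rewrite -szl E.
have H3 := reach_trans H1 H2; rewrite size_map in H3.
have {}H3 := reach_trans H3 (ex_intro2 _ _ t tk _).
rewrite -[l0 :: R]E in Et; have [T tT ET] := H3 _ Et.
(* The run is cubic, O(n) steps for each of O(n^2) pairs; the constant absorbs the set-up for small
   [n]. *)
have TK : T <= 200 * n ^ 4.
  apply: leq_trans tT _; rewrite szR szl.
  have n1 : 0 < n by [].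
  have sl : size lab <= n by [].
  have -> : n ^ 4 = n * (n * (n * n)) by rewrite !expnS expn0 muln1.
  move: (n) n1 sl => k k1 sl; nia.
(* [tm_computes] looks at one exact time, so the remaining steps are spent in the halting
   configuration. *)
have stable k : iter k (tm_step orc) c = c.
  elim: k => // k /= ->; case: c hc1 {hc2 Et ET} => [[q a1] a2] /= ->.
  by rewrite /tm_step /= eqxx.
rewrite /tm_computes -(subnK TK) iterD ET stable; split; first exact: hc1.
rewrite hc2 T1_word cat0s szR szl /pairs /row_out.
elim: (iota 0 n) => //= u us IH; rewrite enc_output_cat IH; congr (_ ++ _).
by rewrite /enc_output -map_comp.
Qed.

End Start.

(** * The automaton computing the prices *)

(** Counters are compared only with 2 and 4, so saturating at 4 keeps the state space finite. *)
Definition cap k : 'I_5 := inord (minn k 4).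
Definition bump (c : 'I_5) : 'I_5 := cap c.+1.

Lemma capE k : cap k = minn k 4 :> nat.
Proof. by rewrite inordK //; lia. Qed.

Lemma bump_cap k : bump (cap k) = cap k.+1.
Proof. by apply: val_inj; rewrite /bump /= !capE; lia. Qed.

(* Summary of the completed components: [u], [v] share a component; they lie in
   paired bad components; parity of the number of bad components; [u] (resp. [v])
   lies in the last bad component; that component ends at a vertex [>= 3];
   [u] lies in the first component; [v] lies in the last one; none so far. *)
Definition summary := (bool * bool * bool * bool * bool * bool * bool * bool * bool)%type.

(* Mode; capped numbers of vertices in the current component, in total, and
   since the start of the last bad component; whether [u], [v] are in the
   current component; summary. *)
Definition dstate := ('I_4 * 'I_5 * 'I_5 * 'I_5 * bool * bool * summary)%type.

Definition dinit (m : 'I_4) : dstate :=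
  (m, cap 0, cap 0, cap 0, false, false,
   (false, false, false, false, false, false, false, false, true)).

Definition dstep (s : dstate) (e isu isv : bool) : dstate :=
  let: (m, cs, pos, since, hu, hv, G) := s in
  let cs := bump cs in let pos := bump pos in let since := bump since in
  let hu := hu || isu in let hv := hv || isv in
  if ~~ e then (m, cs, pos, since, hu, hv, G) else
  let: (same, pr, par, uL, vL, wide, u0, vN, fst) := G in
  let b := 1 < cs < 4 in
  (m, cap 0, pos, if b then cs else since, false, false,
   (same || hu && hv, pr || [&& b, par, uL & hv], par (+) b,
    if b then hu else uL, if b then hv else vL, if b then 4 <= pos else wide,
    if fst then hu else u0, hv, false)).

Arguments dstep : simpl never.

Definition dout (s : dstate) : bool :=
  let: (m, cs, pos, since, hu, hv, (same, pr, par, uL, vL, wide, u0, vN, fst)) := s in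
  ~~ [|| same, (0 < m) && pr |
      [&& 1 < m, par & if wide then u0 && vL else
                       if 4 <= since then uL && vN else (m == 3 :> nat) && (4 <= pos)]].

Section Spec.
Variable lab : seq bool.
Notation n := (size lab).+1.
Notation kap := (kap lab). Notation st := (st lab). Notation bad := (bad lab).
Notation nb := (nb lab). Notation nC := (nC lab).

(** Last bad component before [i]. If there is none, the default 0 makes [x - st (lb i)] equal to
    [x], in accordance with a counter that starts at 0. *)
Fixpoint lb i := if i is j.+1 then if bad j then j else lb j else 0.

Lemma lbP i : 0 < nb i -> [/\ bad (lb i), lb i < i & (nb (lb i)).+1 = nb i].
Proof.
elim: i => // i IH; rewrite nbS /=; case: ifP => bi; first by rewrite addn1.
by rewrite addn0 => /IH[? ? ->]; split=> //; apply: ltnW.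
Qed.

(** Pairing seen from its second member, the form a left-to-right scan can check. *)
Lemma paired_lb i j : paired lab i j = [&& bad j, odd (nb j), 0 < nb j & i == lb j].
Proof.
rewrite /paired; case bj : (bad j); last by rewrite andbF.
rewrite /=; apply/and3P/and3P => [[bi oi /eqP ej]|[oj j0 /eqP ->]].
  have [bl ll nl] : [/\ bad (lb j), lb j < j & (nb (lb j)).+1 = nb j] by apply: lbP; rewrite ej.
  split; rewrite ?ej //; apply/eqP/(@nb_inj lab) => //; lia.
by have [-> ? nl] := lbP j0; rewrite -nl in oj *; split.
Qed.

(** The state after the vertices below [x] have been read. Component [i] is still open; the summary
    speaks only of those before it. *)
Definition dspec (m : 'I_4) u v x : dstate :=
  let i := kap x in
  (m, cap (x - st i), cap x, cap (x - st (lb i)),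
   (u < x) && (kap u == i), (v < x) && (kap v == i),
   ((kap v < i) && (kap u == kap v), (kap v < i) && paired lab (kap u) (kap v), odd (nb i),
    (0 < nb i) && (kap u == lb i), (0 < nb i) && (kap v == lb i),
    (0 < nb i) && (4 <= st (lb i).+1), (0 < i) && (kap u == 0), (kap v).+1 == i, i == 0)).

Lemma st_kapS x : x < n -> kap x.+1 = (kap x).+1 -> st (kap x).+1 = x.+1.
Proof.
move=> xn E; apply/eqP; rewrite eqn_leq [x.+1 <= _]st_lt // ltnSn andbT.
have [xn'|xn'] := ltnP x.+1 n; last by apply: leq_trans (st_le _ _) xn'.
by rewrite leqNgt st_lt // E ltnn.
Qed.

Lemma lb_le i : lb i <= i.
Proof. by elim: i => //= i IH; case: ifP => // _; exact: ltnW. Qed.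

Lemma dspecS m u v x : x < n -> u < n -> v < n ->
  dstep (dspec m u v x) (nth true (rcons lab true) x) (x == u) (x == v) = dspec m u v x.+1.
Proof.
move=> xn un vn.
have /andP[sx xs] := st_kap xn.
have lx : st (lb (kap x)) <= x by apply: leq_trans (st_mono _ (lb_le _)) sx.
have kS := kapS xn.
have hE w : w < n -> (w < x) && (kap w == kap x) || (x == w) = (w < x.+1) && (kap w == kap x).
  move=> wn; rewrite ltnS [w <= x]leq_eqVlt; case: (eqVneq w x) => [->|]; rewrite ?eqxx ?ltnn //=.
  by rewrite orbF eq_sym.
rewrite /dspec /dstep !bump_cap -!subSn // !hE //.
case e : (nth true _ x) kS => /=; rewrite ?addn0 ?addn1 => kS; last by rewrite kS.
have stS := st_kapS xn kS.
have badE : bad (kap x) = (1 < cap (x.+1 - st (kap x)) < 4).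
  by rewrite /bad stS capE; lia.
have inx w : w < n -> (w < x.+1) && (kap w == kap x) = (kap w == kap x).
  move=> wn; case: eqP => //= E; rewrite ?andbF // andbT.
  by have := st_lt (kap x).+1 wn; rewrite stS E ltnSn.
rewrite -badE kS stS subnn /= !inx // nbS.
have kvS : (kap v < (kap x).+1) = (kap v < kap x) || (kap v == kap x) by rewrite ltnS leq_eqVlt orbC.
have out w : w < n -> (w < x.+1) && (kap w == (kap x).+1) = false.
  move=> wn; apply/negbTE/negP => /andP[wx /eqP E].
  by have := kap_mono lab (wx : w <= x); rewrite E ltnn.
rewrite !out //.
congr (_, _, _, _, _, _, (_, _, _, _, _, _, _, _, _)).
- by case: (bad _); rewrite ?stS.
- rewrite kvS andb_orl; congr (_ || _).
  by case: (eqVneq (kap v) (kap x)) => [->|]; rewrite ?andbT ?andbF.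
- rewrite kvS andb_orl; congr (_ || _); rewrite paired_lb.
  by case: (eqVneq (kap v) (kap x)) => [->|]; rewrite ?andbT ?andbF.
- by rewrite oddD; case: (bad _).
- by case: (bad _); rewrite ?addn1 ?addn0.
- by case: (bad _); rewrite ?addn1 ?addn0.
- by case: (bad _); rewrite ?addn1 ?addn0 ?stS ?capE //=; lia.
- by case: (eqVneq (kap x) 0) => [->|] //; rewrite lt0n => ->.
Qed.

Notation labs := (rcons (map Some lab) (None : sym)).

Lemma run_spec m u v x : u < n -> v < n -> x <= n ->
  run dstep u v (dinit m) 0 (take x labs) = dspec m u v x.
Proof.
move=> un vn; elim: x => [|x IH] xn.
  rewrite take0 /= /dspec /dinit kap0 !ltn0 /= ?andbF.
  by congr (_, _, _, _, _, _, (_, _, _, _, _, _, _, _, _)).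
rewrite (take_nth None) ?size_rcons ?size_map // -cats1 run_cat IH 1?ltnW //=.
rewrite add0n size_take size_rcons size_map xn -dspecS //; congr dstep.
rewrite /ends !nth_rcons size_map; case: ltnP => xl; last by case: (x == size lab).
by rewrite (nth_map true) //; case: (nth _ _ _).
Qed.

Lemma flagE m u v : u < n -> v < n -> u < v ->
  flag dinit dstep dout m labs u v = ~~ low lab m u v.
Proof.
move=> un vn uv; rewrite /flag -[X in run _ _ _ _ _ X]take_size.
(* At [x = n] the fictitious last [b]-edge has closed every component, so both [u] and [v] are in
   the summary. *)
rewrite run_spec ?size_rcons ?size_map // /dspec /dout -/nC.
rewrite !kap_lt // !capE /low -/(nB lab) /=; congr (~~ [|| _, _ | _]).
case m1 : (1 < m) => //=; case o : (odd (nB lab)) => //=.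
have B0 : 0 < nB lab by case: (nB lab) o.
have [bl ll nl] := lbP B0.
have LB : lastbad lab (lb nC) by rewrite /lastbad bl nl eqxx.
rewrite (leftoverE m _ _ LB ll) /= nC_gt0 B0 /=.
have -> : (4 <= minn (n - st (lb nC)) 4) = (4 <= n - st (lb nC)) by lia.
have -> : (4 <= minn n 4) = (4 <= n) by lia.
by rewrite -[in (kap v).+1 == _](prednK (nC_gt0 lab)) eqSS.
Qed.

End Spec.

(** * The theorem *)

Local Open Scope ring_scope.

Section Solution.
Variables (orc : seq sym -> bool) (lab : seq bool).
Notation n := (size lab).+1.
Notation L := (pairs dinit dstep dout orc lab).

Lemma pairsE : L = [seq (u, v, flags dinit dstep dout orc lab u v) |
  u <- iota 0 n, v <- iota u.+2 (n - u.+2)].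
Proof. by []. Qed.

Lemma mem_pairs u v f : (v < n)%N ->
  ((u, v, f) \in L) = (u.+2 <= v)%N && (f == flags dinit dstep dout orc lab u v).
Proof.
move=> vn; rewrite pairsE; apply/allpairsPdep/andP.
  by case=> u' [v' [_ + [-> -> ->]]]; rewrite mem_iota => /andP[-> _]; rewrite eqxx.
case=> uv /eqP ->; exists u, v; split=> //; rewrite mem_iota //; last by rewrite uv subnKC ?vn //; lia.
by move: uv vn; lia.
Qed.

Lemma pairs_fst : [seq t.1 | t <- L] = [seq (u, v) | u <- iota 0 n, v <- iota u.+2 (n - u.+2)].
Proof. by rewrite pairsE map_allpairs. Qed.

Lemma pairs_wf : sol_wf lab L.
Proof.
split.
  rewrite pairs_fst; apply: allpairs_uniq_dep; rewrite ?iota_uniq //.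
    by move=> u _; apply: iota_uniq.
  by move=> [u v] [u' v'] _ _ /= [-> ->].
apply/allP => t; rewrite pairsE => /allpairsPdep[u [v [_ + ->]]].
by rewrite mem_iota /nV /=; lia.
Qed.

Lemma sol_set_pairs : sol_set lab L = blue lab.
Proof.
apply/setP => e; rewrite !inE pairs_fst; apply/allpairsPdep/idP.
  by case=> u [v [_ + [-> ->]]]; rewrite mem_iota => /andP[].
move=> e12; exists (val e.1), (val e.2); split=> //; rewrite mem_iota.
  by rewrite add0n /= ltn_ord.
rewrite e12 /= subnKC; first exact: (ltn_ord e.2).
exact: leq_trans e12 (ltnW (ltn_ord e.2)).
Qed.

Lemma sol_price_pairs (R : realType) (a b : R) e : e \in blue lab ->
  sol_price a b lab L e = if e \in blue_low lab (mode orc) then a else b.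
Proof.
move=> eb; rewrite /sol_price mem_pairs ?ltn_ord // [e \in blue_low _ _]inE eb.
have e12 : (e.1.+2 <= e.2)%N by move: eb; rewrite inE.
rewrite e12 /flags flagE ?ltn_ord //; last exact: ltnW.
by case: (low _ _ _ _).
Qed.

End Solution.

Lemma mode_spec (R : realType) (a b : R) orc : 0 <= a -> comparison_oracle a b orc ->
  let mu : nat := mode orc in
  [/\ (mu == 0%N) = (3 * a <= b), (1 < mu)%N -> b <= 2 * a,
      (mu <= 1)%N -> mu = 1%N -> 2 * a <= b &
      (mu = 2%N -> 3 * a <= 2 * b) /\ (mu = 3%N -> 2 * b <= 3 * a)].
Proof.
move=> a0 oP /=; rewrite /mode !oP !mul0r !mul1r !add0r !addr0.
case: lerP => h1; first by rewrite inordK.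
case: lerP => h2; first by rewrite inordK //; split=> // _ _; lra.
case: lerP => h3; rewrite inordK //; split=> //.
- by move=> _; lra.
- by move=> _; lra.
- by split=> // _; lra.
Qed.

Theorem theorem1 :
  exists (M : OTM) (c k : nat),
    forall (R : realType) (a b : R), 0 <= a -> a < b ->
    forall orc : seq sym -> bool, comparison_oracle a b orc ->
    forall lab : seq bool,
      exists L : seq (nat * nat * bool),
        [/\ tm_computes M orc (enc_input lab) (c * (size lab).+1 ^ k)%N (enc_output L),
            sol_wf lab L &
            optimal_strategy a b lab (sol_set lab L) (sol_price a b lab L)].
Proof.
exists (machine dinit dstep dout), 200, 4 => R a b a0 ab orc oP lab.
exists (pairs dinit dstep dout orc lab); split; first exact: machine_computes.
  exact: pairs_wf.
have pE e := @sol_price_pairs orc lab R a b e.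
rewrite sol_set_pairs; split; first exact: blue_valid.
  by move=> e /pE ->; case: ifP => _ //; apply: le_trans (ltW ab).
have sE : blue_low lab (mode orc) \subset blue lab by apply/subsetP => e; rewrite inE => /andP[].
have [v [lr v0 le_v]] := revenue_lower ab (@blue_valid lab) sE pE a0.
exists v; split=> // F' p' v' vF' _ lr'.
exact: (optimal a0 ab vF' lr' (mode_spec a0 oP) v0 le_v).
Qed.
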